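(* Let $\mathbb{X}$ be an ACM set of points in $\mathbb{P}^1\times\mathbb{P}^1$, and suppose that \[0\rightarrow\mathbb{F}_2\rightarrow\mathbb{F}_1\rightarrow R\rightarrow R/I_{\mathbb{X}}\rightarrow0\] is the minimal $\mathbb{N}^2$-graded free resolution of $R/I_{\mathbb{X}}$. Let $P\in\mathbb{X}$ be a point with $\deg_{\mathbb{X}}(P)=(\alpha_1,\alpha_2)$, and let $\mathbb{Y}=\mathbb{X}\setminus\{P\}$. Then $\mathbb{Y}$ is not ACM if and only if $R/I_{\mathbb{Y}}$ has a minimal $\mathbb{N}^2$-graded free resolution of the form \[0\rightarrow R(-\alpha_1-1,-\alpha_2-1)\rightarrow \mathbb{F}_2\oplus R(-\alpha_1-1,-\alpha_2)\oplus R(-\alpha_1,-\alpha_2-1)\rightarrow \mathbb{F}_1\oplus R(-\alpha_1,-\alpha_2)\rightarrow R\rightarrow R/I_{\mathbb{Y}}\rightarrow0.\]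
   Context: Let $k$ be an algebraically closed field of characteristic zero, $\mathbb{N}=\{0,1,2,\ldots\}$, and let $R=k[x_0,x_1,y_0,y_1]$ be $\mathbb{N}^2$-graded by $\deg x_0=\deg x_1=(1,0)$, $\deg y_0=\deg y_1=(0,1)$. For a finite set of points $\mathbb{X}$ in $\mathbb{P}^1\times\mathbb{P}^1$ (over $k$), $I_{\mathbb{X}}\subseteq R$ is the bihomogeneous ideal generated by the bihomogeneous forms vanishing at all points of $\mathbb{X}$ (so $I_\emptyset=R$). For nonempty $\mathbb{X}$ one has $\dim R/I_{\mathbb{X}}=2$; $\mathbb{X}$ is arithmetically Cohen–Macaulay (ACM) if $\operatorname{depth}R/I_{\mathbb{X}}=2$. The empty set is regarded as ACM. Order $\mathbb{N}^2$ by $(i_1,i_2)\succeq(j_1,j_2)$ iff $i_1\ge j_1$ and $i_2\ge j_2$. For $P\in\mathbb{X}$, a bihomogeneous form $F\in R$ is a separator for $P$ if $F(P)\neq0$ and $F(Q)=0$ for all $Q\in\mathbb{X}\setminus\{P\}$. The degree of $P\in\mathbb{X}$ is the set $\deg_{\mathbb{X}}(P)$ of minimal elements of $\{\deg F : F\text{ is a separator for }P\in\mathbb{X}\}\subseteq\mathbb{N}^2$. It is known that if $\mathbb{X}$ is ACM then $|\deg_{\mathbb{X}}(P)|=1$ for every $P\in\mathbb{X}$; in that case one writes $\deg_{\mathbb{X}}(P)=(\alpha_1,\alpha_2)$ for its unique element. *)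

(* Defs.v *)
From HB Require Import structures.
From mathcomp Require Import all_boot all_order all_algebra generic_quotient.
From mathcomp Require Import finmap mpoly.

Set Implicit Arguments.
Unset Strict Implicit.
Unset Printing Implicit Defensive.

Import GRing.Theory.
Local Open Scope quotient_scope.
Local Open Scope ring_scope.

Definition nzvec (k : fieldType) := {v : 'rV[k]_2 | v != 0}.

Definition same_line (k : fieldType) (u v : nzvec k) : bool :=
  (val u == val v)%MS.

Lemma same_line_equiv (k : fieldType) : equiv_class_of (@same_line k).
Proof.
split=> [u|u v|v u w]; rewrite /same_line.
- by rewrite submx_refl.
- by rewrite andbC.
- by move=> /eqmxP uv /eqmxP vw; apply/eqmxP; apply: eqmx_trans uv vw.
Qed.

Canonical same_line_equiv_rel (k : fieldType) :=
  EquivRelPack (same_line_equiv k).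

Definition P1 (k : fieldType) := {eq_quot @same_line k}.
HB.instance Definition _ (k : fieldType) := Choice.on (P1 k).

Definition P1xP1 (k : fieldType) := (P1 k * P1 k)%type.
HB.instance Definition _ (k : fieldType) := Choice.on (P1xP1 k).

Definition bidegree := (nat * nat)%type.

Definition deg_le (d e : bidegree) : bool := (d.1 <= e.1)%N && (d.2 <= e.2)%N.

(* The variables are indexed by 'I_(2 + 2): the first summand holds x0, x1 and
   the second y0, y1. *)
Notation bipoly k := {mpoly k[2 + 2]}.

Definition mbideg (m : 'X_{1..2 + 2}) : bidegree :=
  (\sum_(i < 2) m (lshift 2 i), \sum_(j < 2) m (rshift 2 j))%N.

Definition bihomogeneous (k : fieldType) (d : bidegree) (f : bipoly k) :
  Prop := forall m, m \in msupp f -> mbideg m = d.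

Definition coords (k : fieldType) (u v : 'rV[k]_2) : 'I_(2 + 2) -> k :=
  row_mx u v 0.

(* Evaluation at arbitrary representatives of the two components of P. Only
   the (non)vanishing of a bihomogeneous form is meaningful; see
   [bihomogeneous_vanishes]. *)
Definition eval_at (k : fieldType) (f : bipoly k) (P : P1xP1 k) : k :=
  f.@[coords (val (repr P.1)) (val (repr P.2))].

Lemma bihomogeneous_scale (k : fieldType) (d : bidegree) (f : bipoly k)
    (a b : k) (u v : 'rV[k]_2) :
  bihomogeneous d f ->
  f.@[coords (a *: u) (b *: v)] = a ^+ d.1 * b ^+ d.2 * f.@[coords u v].
Proof.
move=> hf; rewrite !mevalE mulr_sumr !big_seq; apply: eq_bigr => m /hf <- /=.
rewrite mulrCA; congr (_ * _); rewrite !big_split_ord /=.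
rewrite mulrACA !expr_sum; congr (_ * _); rewrite -big_split /=;
  by apply: eq_bigr => i _; rewrite /coords ?(row_mxEl, row_mxEr) mxE exprMn.
Qed.

Lemma bihomogeneous_vanishes (k : fieldType) (d : bidegree)
    (f : bipoly k) (u v : nzvec k) :
  bihomogeneous d f ->
  (eval_at f (\pi_(P1 k) u, \pi_(P1 k) v) == 0) = (f.@[coords (val u) (val v)] == 0).
Proof.
have line (w : nzvec k) :
    exists2 c, c != 0 & val (repr (\pi_(P1 k) w)) = c *: val w.
  have /eqmodP : \pi_(P1 k) (repr (\pi_(P1 k) w)) = \pi_(P1 k) w by rewrite reprK.
  rewrite /= /same_line => /andP[/sub_rVP[c hc] _]; exists c => //.
  apply/eqP => c0; move: (valP (repr (\pi_(P1 k) w))).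
  by rewrite hc c0 scale0r eqxx.
move=> hf; rewrite /eval_at /=.
have [a a0 ->] := line u; have [b b0 ->] := line v.
rewrite (bihomogeneous_scale _ _ _ _ hf) !mulf_eq0.
by rewrite !expf_eq0 (negbTE a0) (negbTE b0) !andbF.
Qed.

Definition ideal_gen (A : comNzRingType) (S : A -> Prop) (f : A) : Prop :=
  exists (n : nat) (g h : 'I_n -> A),
    (forall i, S (h i)) /\ f = \sum_(i < n) g i * h i.

Definition ideal_of_points (k : fieldType) (X : {fset P1xP1 k}) :
    bipoly k -> Prop :=
  ideal_gen (fun f => (exists d, bihomogeneous d f) /\
                      (forall Q, Q \in X -> eval_at f Q = 0)).

Definition irrelevant_ideal (k : fieldType) : bipoly k -> Prop :=
  ideal_gen (fun f => exists i, f = 'X_i).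

(* [regular_seq I s]: the sequence s is regular on the module A / I. *)
Fixpoint regular_seq (A : comNzRingType) (I : A -> Prop) (s : seq A) : Prop :=
  if s is f :: s' then
    (forall g, I (f * g) -> I g) /\
    regular_seq (ideal_gen (fun h => I h \/ h = f)) s'
  else ~ I 1.

(* [depth_quotient I n]: the depth of R / I, i.e. the maximal length of a
   regular sequence in the irrelevant maximal ideal, is n. *)
Definition depth_quotient (k : fieldType) (I : bipoly k -> Prop)
    (n : nat) : Prop :=
  let reg s := (forall f, f \in s -> irrelevant_ideal f) /\ regular_seq I s in
  (exists s, reg s /\ size s = n) /\ (forall s, reg s -> (size s <= n)%N).

Definition ACM (k : fieldType) (X : {fset P1xP1 k}) : Prop :=
  X = fset0 \/ depth_quotient (ideal_of_points X) 2.

Definition separator (k : fieldType) (X : {fset P1xP1 k}) (P : P1xP1 k)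
    (f : bipoly k) : Prop :=
  eval_at f P <> 0 /\ (forall Q, Q \in X -> Q <> P -> eval_at f Q = 0).

Definition minimal_degree (S : bidegree -> Prop) (d : bidegree) : Prop :=
  S d /\ (forall e, S e -> deg_le e d -> e = d).

Definition point_degree (k : fieldType) (X : {fset P1xP1 k}) (P : P1xP1 k) :
    bidegree -> Prop :=
  minimal_degree (fun d => exists f, bihomogeneous d f /\ separator X P f).

(* A finite free bigraded module (+)_j R(-e_j) is given by the list of its
   shifts e_j; its elements are row vectors, and matrices act on the right. *)
Definition free_module := seq bidegree.

(* A matrix defines a degree-preserving map D -> E iff its (i, j) entry is
   bihomogeneous of degree D_i - E_j (hence zero when this is not in N^2). *)
Definition graded_map (k : fieldType) (D E : free_module)
    (M : 'M[bipoly k]_(size D, size E)) : Prop :=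
  forall i j m, m \in msupp (M i j) ->
    mbideg m + nth (0, 0)%N E j = nth (0, 0)%N D i.

(* The free modules of a resolution of a cyclic module: R, followed by the
   members of Fs, followed by zeros. *)
Definition res_module (Fs : seq free_module) (i : nat) : free_module :=
  nth [::] ([:: (0, 0)%N] :: Fs) i.

(* [delta i] is the differential from the module of index i + 1 to that of
   index i; the augmentation is the canonical projection from R to R / I. *)
Record minimal_resolution (k : fieldType) (I : bipoly k -> Prop)
    (Fs : seq free_module)
    (delta : forall i, 'M[bipoly k]_(size (res_module Fs i.+1),
                                      size (res_module Fs i))) : Prop :=
  MinimalResolution {
    res_graded : forall i, graded_map (delta i);
    res_augmentation : forall f : bipoly k,
      I f <-> exists w, w *m delta 0%N = f%:M;
    res_exact : forall i (v : 'rV_(size (res_module Fs i.+1))),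
      v *m delta i = 0 <-> exists w, w *m delta i.+1 = v;
    res_minimal : forall i r s, irrelevant_ideal (delta i r s)
  }.

(* 0 -> F_n -> ... -> F_1 -> R -> R / I -> 0 with Fs = [:: F_1; ...; F_n]. *)
Definition has_minimal_resolution (k : fieldType)
    (I : bipoly k -> Prop) (Fs : seq free_module) : Prop :=
  exists delta, @minimal_resolution k I Fs delta.

(* Main.v *)
Require Import Defs.
From mathcomp Require Import all_boot all_order all_algebra.
From mathcomp Require Import finmap mpoly ring.
From Stdlib Require Import Classical.

Set Implicit Arguments.
Unset Strict Implicit.
Unset Printing Implicit Defensive.

Import GRing.Theory.
Local Open Scope ring_scope.

(** Write [Y] for [X] without [P], [I_X] and [I_Y] for the ideals of the two
sets of points, and let [F] be a separator for [P] of degree [a = (a1, a2)].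
Let [L] and [M] be the forms of degrees (1,0) and (0,1) that vanish at [P].

The shape of the resolution is that of a mapping cone. As [a] is the only
minimal degree of a separator, every form [G] of degree [d] in [I_Y] with
[G(P) <> 0] has [d >= a]; subtracting from it a multiple of [F] makes it vanish
on all of [X], so [I_Y = I_X + (F)] ([ideal_delete_point]). Evaluation at [P]
gives [I_X : F = (L, M)] ([separator_colon]). Thus
[0 -> R/(L, M)(-a) -> R/I_X -> R/I_Y -> 0] is exact. Lifting multiplication by
[F] to a map from the Koszul complex of [(L, M)] to the resolution of [R/I_X]
gives rows [w1], [w2] over [F1] and [u] over [F2], and the cone of this lift is a
graded resolution of [R/I_Y] with the displayed shifts ([cone_resolution]). What
remains is to relate its minimality to the depth of [R/I_Y].

Depth is tested on two linear forms [l = x0 + c x1] and [m = y0 + e y1] that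
vanish at no point of [X]; a quotient by the ideal of a nonempty set of such
points has depth 2 if and only if [(l, m)] is a regular sequence on it
([depth_two_regular], [regular_depth_two]). The reason is that the vanishing of
the socle of [R / (I, x)] does not depend on the regular element [x] of the
irrelevant ideal ([socle_free_exchange]), and that [x1] and [y1] act nilpotently on the quotient
by [(I, l, m)], so that zero divisors produce socle elements. When [(l, m)] is
regular, a resolution remains exact modulo [(l, m)] ([resolution_exact_mod]).

Suppose that [R/I_Y] has the displayed resolution and depth 2. Reduced modulo
[(l, m)] it remains exact, over the ring [k[x1, y1]] in which [x1, y1] is a
regular sequence. Its last map is a single row with entries in the ideal
[(x1, y1)], and the Koszul relations of [x1] and [y1] force [1] to lie in that
ideal ([depth_two_last_map]).

Suppose that [Y] is not ACM. If [F] were not in [(I_X, l, m)], then [(l, m)] would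
be regular on [R/I_Y] ([regular_after_separator]) and [Y] would be ACM. So [F] is
in [(I_X, l, m)], and exactness modulo [(l, m)] shows that [u] has its entries in
the irrelevant ideal ([cone_map_mod]). Comparing linear terms in
[u d1 = M w1 - L w2] gives the same for [w1] and [w2] ([cone_minimal]), so the
cone is minimal. *)

(** * Ideals, socles and regular sequences *)

(** Ideals as propositional predicates, the form in which [ideal_gen] produces
them. *)
Definition is_ideal (A : comNzRingType) (J : A -> Prop) : Prop :=
  [/\ J 0, forall f g, J f -> J g -> J (f + g) & forall a f, J f -> J (a * f)].

Definition adjoin (A : comNzRingType) (J : A -> Prop) (f : A) : A -> Prop :=
  ideal_gen (fun h => J h \/ h = f).

Definition regular_mod (A : comNzRingType) (J : A -> Prop) (f : A) : Prop :=
  forall g, J (f * g) -> J g.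

Lemma ideal_gen_ideal (A : comNzRingType) (S : A -> Prop) :
  is_ideal (ideal_gen S).
Proof.
split.
- by exists 0%N, (fun=> 0), (fun=> 0); split=> [[]//|]; rewrite big_ord0.
- move=> _ _ [n1 [g1 [h1 [S1 ->]]]] [n2 [g2 [h2 [S2 ->]]]].
  pose sel (B : Type) (a1 : 'I_n1 -> B) (a2 : 'I_n2 -> B) i :=
    match split i with inl i1 => a1 i1 | inr i2 => a2 i2 end.
  exists (n1 + n2)%N, (sel _ g1 g2), (sel _ h1 h2); split.
    by move=> i; rewrite /sel; case: (split i).
  rewrite big_split_ord /sel /=; congr (_ + _); apply: eq_bigr => i _.
    by case: split_ordP => j /eqP; rewrite ?eq_lshift ?eq_lrshift // => /eqP <-.
  by case: split_ordP => j /eqP; rewrite ?eq_rshift ?eq_rlshift // => /eqP <-.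
- move=> a _ [n [g [h [Sh ->]]]]; exists n, (fun i => a * g i), h; split=> //.
  by rewrite mulr_sumr; apply: eq_bigr => i _; rewrite mulrA.
Qed.

Lemma ideal_gen_mem (A : comNzRingType) (S : A -> Prop) f :
  S f -> ideal_gen S f.
Proof.
by move=> Sf; exists 1%N, (fun=> 1), (fun=> f); split=> //; rewrite big_ord1 mul1r.
Qed.

Lemma is_ideal_sum (A : comNzRingType) (J : A -> Prop) (I : Type) (r : seq I)
    (Q : pred I) (F : I -> A) :
  is_ideal J -> (forall i, Q i -> J (F i)) -> J (\sum_(i <- r | Q i) F i).
Proof. by case=> J0 JD _ JF; apply: big_ind. Qed.

Lemma ideal_gen_sub (A : comNzRingType) (S J : A -> Prop) :
  is_ideal J -> (forall f, S f -> J f) -> forall f, ideal_gen S f -> J f.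
Proof.
move=> idJ SJ _ [n [g [h [Sh ->]]]]; apply: is_ideal_sum => // i _.
by case: idJ => _ _; apply; apply: SJ.
Qed.

Lemma is_idealN (A : comNzRingType) (J : A -> Prop) f :
  is_ideal J -> J f -> J (- f).
Proof. by case=> _ _ JM Jf; rewrite -mulN1r; apply: JM. Qed.

Lemma is_idealB (A : comNzRingType) (J : A -> Prop) f g :
  is_ideal J -> J f -> J g -> J (f - g).
Proof. by move=> idJ Jf /(is_idealN idJ); case: idJ => _ JD _; apply: JD. Qed.

Lemma is_idealMr (A : comNzRingType) (J : A -> Prop) f a :
  is_ideal J -> J f -> J (f * a).
Proof. by case=> _ _ JM Jf; rewrite mulrC; apply: JM. Qed.

Lemma adjoinP (A : comNzRingType) (J : A -> Prop) f g :
  is_ideal J -> adjoin J f g <-> exists t, J (g - t * f).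
Proof.
move=> idJ; split; last first.
  have [_ JD JM] := ideal_gen_ideal (fun h => J h \/ h = f).
  case=> t Jg; rewrite -(subrK (t * f) g); apply: JD.
    by apply: ideal_gen_mem; left.
  by apply: JM; apply: ideal_gen_mem; right.
have [J0 JD JM] := idJ.
apply: (ideal_gen_sub (J := fun g => exists t, J (g - t * f))) => [|h [Jh|->]];
  last 2 first.
- by exists 0; rewrite mul0r subr0.
- by exists 1; rewrite mul1r subrr.
split.
- by exists 0; rewrite mul0r subr0.
- move=> u v [s Ju] [t Jv]; exists (s + t).
  by rewrite mulrDl opprD addrACA; apply: JD.
- move=> a u [s Ju]; exists (a * s).
  by rewrite -mulrA -mulrBr; apply: JM.
Qed.

Lemma adjoin_ideal (A : comNzRingType) (J : A -> Prop) f : is_ideal (adjoin J f).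
Proof. exact: ideal_gen_ideal. Qed.

Lemma adjoin_sub (A : comNzRingType) (J : A -> Prop) f g : J g -> adjoin J f g.
Proof. by move=> Jg; apply: ideal_gen_mem; left. Qed.

Lemma adjoin_gen (A : comNzRingType) (J : A -> Prop) f t : adjoin J f (t * f).
Proof.
by case: (adjoin_ideal J f) => _ _; apply; apply: ideal_gen_mem; right.
Qed.

Lemma adjoin_mono (A : comNzRingType) (J J' : A -> Prop) f g :
  (forall h, J h -> J' h) -> adjoin J f g -> adjoin J' f g.
Proof.
move=> JJ'; apply: ideal_gen_sub => [|h [/JJ' J'h|->]]; first exact: adjoin_ideal.
  exact: adjoin_sub.
by apply: ideal_gen_mem; right.
Qed.

(** For an element [x] of an ideal [m] that is regular on [A/J], the elements of
[A / (J, x)] killed by [m] form [Ext^1(A/m, A/J)], which does not involve [x]. The exchange is explicit: if [m n] is in [(J, x)], write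
[f1 n = n1 x] modulo [J]; then [m n1] is in [(J, f1)], so [n1] is in [(J, f1)] by
regularity of [f2], and dividing by [f1] puts [n] in [(J, x)]. *)
Lemma socle_free_exchange (A : comNzRingType) (m J : A -> Prop) (f1 f2 x n : A) :
  is_ideal J -> m f1 -> m f2 ->
  regular_mod J f1 -> regular_mod (adjoin J f1) f2 -> regular_mod J x ->
  (forall z, m z -> adjoin J x (z * n)) -> adjoin J x n.
Proof.
move=> idJ m1 m2 reg1 reg2 regx soc.
have [J0 JD JM] := idJ.
have /adjoinP-/(_ idJ) [n1 Jn1] := soc _ m1.
have : adjoin J f1 (f2 * n1).
  have /adjoinP-/(_ idJ) [a Ja] := soc _ m2.
  apply/adjoinP => //; exists a; apply: regx.
  rewrite (_ : _ * _ = f1 * (f2 * n - a * x) - f2 * (f1 * n - n1 * x)); last by ring.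
  by apply: is_idealB => //; apply: JM.
move=> /reg2 /adjoinP-/(_ idJ) [b Jb]; apply/adjoinP => //; exists b; apply: reg1.
rewrite (_ : _ * _ = (f1 * n - n1 * x) + x * (n1 - b * f1)); last by ring.
by apply: JD => //; apply: JM.
Qed.

(** The analogue of [socle_free_exchange] one step higher: for an ideal [m]
containing [x] and [y], the elements of [A / (J, x, y)] killed by [m] form
[Ext^2(A/m, A/J)], which vanishes as soon as [m] contains a regular sequence of
length 3. Writing [f n] in terms of [x] and
[y] for two elements [f] of [m] and comparing produces an element [c] with [m c]
in [(J, f1, f2)]; regularity of [f3] and of [f2] then divides everything back. *)
Lemma no_regular_triple (A : comNzRingType) (m J : A -> Prop) (f1 f2 f3 x y n : A) :
  is_ideal J -> m f1 -> m f2 -> m f3 ->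
  regular_mod J f1 -> regular_mod (adjoin J f1) f2 ->
  regular_mod (adjoin (adjoin J f1) f2) f3 ->
  regular_mod J x -> regular_mod (adjoin J x) y ->
  (forall z, m z -> adjoin (adjoin J x) y (z * n)) -> adjoin (adjoin J x) y n.
Proof.
move=> idJ m1 m2 m3 reg1 reg2 reg3 regx regy soc.
have [J0 JD JM] := idJ.
have adj2 f g h : adjoin (adjoin J f) g h <-> exists s t, J (h - s * f - t * g).
  split=> [/adjoinP-/(_ (adjoin_ideal _ _)) [t /adjoinP-/(_ idJ) [s Jst]]|[s [t Jst]]].
    by exists s, t; rewrite addrAC.
  apply/adjoinP; first exact: adjoin_ideal.
  by exists t; apply/adjoinP => //; exists s; rewrite addrAC.
have [a [b Jab]] := (adj2 _ _ _).1 (soc _ m1).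
have [a2 [b2 Jab2]] := (adj2 _ _ _).1 (soc _ m2).
(* As (x, y) is regular modulo J, every relation between x and y is a multiple of
   the Koszul one. *)
have koszul u v : J (u * x + v * y) -> exists c, J (v - c * x) /\ J (u + c * y).
  move=> Juv; have /regy/adjoinP-/(_ idJ) [c Jc] : adjoin J x (y * v).
    apply/adjoinP => //; exists (- u); rewrite (_ : _ - _ = u * x + v * y) //; ring.
  exists c; split=> //; apply: regx.
  rewrite (_ : _ * _ = (u * x + v * y) - y * (v - c * x)); last by ring.
  by apply: is_idealB => //; apply: JM.
(* c measures how far the representations of f1 n and f2 n are from coming from a
   representation of n. *)
have [c [Jcb Jca]] : exists c,
    J (f2 * b - f1 * b2 - c * x) /\ J (f2 * a - f1 * a2 + c * y).
  apply: koszul.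
  rewrite (_ : _ + _ =
    f1 * (f2 * n - a2 * x - b2 * y) - f2 * (f1 * n - a * x - b * y)); last by ring.
  by apply: is_idealB => //; apply: JM.
have : adjoin (adjoin J f1) f2 (f3 * c).
  have [a3 [b3 Jab3]] := (adj2 _ _ _).1 (soc _ m3).
  have [c1 [Jc1 _]] : exists c1,
      J (f3 * b - f1 * b3 - c1 * x) /\ J (f3 * a - f1 * a3 + c1 * y).
    apply: koszul.
    rewrite (_ : _ + _ =
      f1 * (f3 * n - a3 * x - b3 * y) - f3 * (f1 * n - a * x - b * y)); last by ring.
    by apply: is_idealB => //; apply: JM.
  have [d [Jd _]] : exists d,
      J (f3 * b2 - f2 * b3 - d * x) /\ J (f3 * a2 - f2 * a3 + d * y).
    apply: koszul.
    rewrite (_ : _ + _ =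
      f2 * (f3 * n - a3 * x - b3 * y) - f3 * (f2 * n - a2 * x - b2 * y)); last by ring.
    by apply: is_idealB => //; apply: JM.
  apply/adj2; exists (- d), c1; apply: regx.
  rewrite (_ : _ * _ = f2 * (f3 * b - f1 * b3 - c1 * x)
     - f3 * (f2 * b - f1 * b2 - c * x) - f1 * (f3 * b2 - f2 * b3 - d * x)); last by ring.
  by apply: is_idealB => //; [apply: is_idealB => //|]; apply: JM.
move=> /reg3 /adj2 [d [e Jde]].
have /reg2/adjoinP-/(_ idJ) [g Jg] : adjoin J f1 (f2 * (b - e * x)).
  apply/adjoinP => //; exists (b2 + d * x).
  rewrite (_ : _ - _ =
    (f2 * b - f1 * b2 - c * x) + x * (c - d * f1 - e * f2)); last by ring.
  by apply: JD => //; apply: JM.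
have /reg2/adjoinP-/(_ idJ) [h Jh] : adjoin J f1 (f2 * (a + e * y)).
  apply/adjoinP => //; exists (a2 - d * y).
  rewrite (_ : _ - _ =
    (f2 * a - f1 * a2 + c * y) - y * (c - d * f1 - e * f2)); last by ring.
  by apply: is_idealB => //; apply: JM.
apply/adj2; exists h, g; apply: reg1.
rewrite (_ : _ * _ = (f1 * n - a * x - b * y) + x * (a + e * y - h * f1)
  + y * (b - e * x - g * f1)); last by ring.
by apply: (JD); [apply: JD => //|]; apply: JM.
Qed.

Lemma last_nonzero_power (A : comNzRingType) (N : A -> Prop) (u n : A) r :
  ~ N n -> N (u ^+ r * n) -> exists a, ~ N (u ^+ a * n) /\ N (u * (u ^+ a * n)).
Proof.
move=> Nn; elim: r => [|r IHr]; first by rewrite expr0 mul1r.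
rewrite exprS -mulrA => Nr; case: (classic (N (u ^+ r * n))) => [/IHr //|nNr].
by exists r.
Qed.

(** Multiplying [n] by the last power of [u], and then by the last power of [v],
that stays outside [N] gives an element outside [N] that [u] and [v] carry into
[N]. *)
Lemma socle_of_nilpotents (A : comNzRingType) (N : A -> Prop) (u v n : A) r s :
  is_ideal N -> ~ N n -> N (u ^+ r * n) -> N (v ^+ s * n) ->
  exists t, [/\ ~ N (t * n), N (u * (t * n)) & N (v * (t * n))].
Proof.
move=> [_ _ NM] Nn Nu Nv; have [a [nNa Na]] := last_nonzero_power Nn Nu.
have [|b [nNb Nb]] := last_nonzero_power (u := v) (r := s) nNa.
  by rewrite mulrCA; apply: NM.
exists (v ^+ b * u ^+ a); rewrite -mulrA; split=> //.
by rewrite mulrCA; apply: NM.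
Qed.

(** * Complexes of matrices modulo an ideal *)

Definition mx_in (A : comNzRingType) (J : A -> Prop) p q (M : 'M[A]_(p, q)) :
  Prop := forall i j, J (M i j).

Definition exact_mod (A : comNzRingType) (J : A -> Prop) p q r
    (M : 'M[A]_(p, q)) (N : 'M[A]_(q, r)) : Prop :=
  forall v : 'rV_q, mx_in J (v *m N) -> exists w : 'rV_p, mx_in J (v - w *m M).

(** The condition that [f] is regular on the cokernel of [N] modulo [J]. *)
Definition saturated_image (A : comNzRingType) (J : A -> Prop) (f : A) q r
    (N : 'M[A]_(q, r)) : Prop :=
  forall (v : 'rV_q) (w : 'rV_r), mx_in J (v *m N - f *: w) ->
    exists u : 'rV_q, mx_in J (w - u *m N).

Definition zero_ideal (A : comNzRingType) (f : A) : Prop := f = 0.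

Lemma zero_ideal_ideal (A : comNzRingType) : is_ideal (@zero_ideal A).
Proof.
by split=> [|f g -> ->|a f ->]; rewrite /zero_ideal ?addr0 ?mulr0.
Qed.

Lemma zero_ideal_mx (A : comNzRingType) p q (M : 'M[A]_(p, q)) :
  mx_in (@zero_ideal A) M <-> M = 0.
Proof.
by split=> [M0|-> i j]; [apply/matrixP=> i j; rewrite M0|]; rewrite /zero_ideal mxE.
Qed.

Lemma mx_inB (A : comNzRingType) (J : A -> Prop) p q (M N : 'M[A]_(p, q)) :
  is_ideal J -> mx_in J M -> mx_in J N -> mx_in J (M - N).
Proof. by move=> idJ JM JN i j; rewrite !mxE; apply: is_idealB. Qed.

Lemma mx_inD (A : comNzRingType) (J : A -> Prop) p q (M N : 'M[A]_(p, q)) :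
  is_ideal J -> mx_in J M -> mx_in J N -> mx_in J (M + N).
Proof. by case=> _ JD _ JM JN i j; rewrite !mxE; apply: JD. Qed.

Lemma mx_inZ (A : comNzRingType) (J : A -> Prop) p q a (M : 'M[A]_(p, q)) :
  is_ideal J -> mx_in J M -> mx_in J (a *: M).
Proof. by case=> _ _ JM JMM i j; rewrite !mxE; apply: JM. Qed.

Lemma mx_in_mull (A : comNzRingType) (J : A -> Prop) p q r
    (M : 'M[A]_(p, q)) (N : 'M[A]_(q, r)) :
  is_ideal J -> mx_in J N -> mx_in J (M *m N).
Proof.
move=> idJ JN i j; rewrite mxE; apply: is_ideal_sum => // l _.
by case: idJ => _ _; apply.
Qed.

Lemma mx_in_mulr (A : comNzRingType) (J : A -> Prop) p q r
    (M : 'M[A]_(p, q)) (N : 'M[A]_(q, r)) :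
  is_ideal J -> mx_in J M -> mx_in J (M *m N).
Proof.
move=> idJ JM i j; rewrite mxE; apply: is_ideal_sum => // l _.
exact: (is_idealMr _ idJ (JM _ _)).
Qed.

Lemma mx_in_congr (A : comNzRingType) (J : A -> Prop) p q (M N : 'M[A]_(p, q)) :
  is_ideal J -> mx_in J (M - N) -> mx_in J N -> mx_in J M.
Proof. by move=> idJ JMN JN; rewrite -(subrK N M); apply: mx_inD. Qed.

Lemma mx_in_adjoin (A : comNzRingType) (J : A -> Prop) f q (v : 'rV[A]_q) :
  is_ideal J -> mx_in (adjoin J f) v -> exists w, mx_in J (v - f *: w).
Proof.
move=> idJ Jv.
have /fin_all_exists [t Jt] j : exists t, J (v 0 j - t * f) by apply/adjoinP.
by exists (\row_j t j) => i j; rewrite !mxE ord1 mulrC.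
Qed.

Lemma adjoin_mx_in (A : comNzRingType) (J : A -> Prop) f p q (v w : 'M[A]_(p, q)) :
  mx_in J (v - f *: w) -> mx_in (adjoin J f) v.
Proof.
move=> Jvw i j; rewrite -(subrK (w i j * f) (v i j)).
have [_ JD _] := adjoin_ideal J f; apply: JD; last exact: adjoin_gen.
by apply: adjoin_sub; have := Jvw i j; rewrite !mxE mulrC.
Qed.

(** The cokernel of [M] embeds in a free module by exactness, so an element regular
on [A/J] is regular on it. *)
Lemma exact_saturated (A : comNzRingType) (J : A -> Prop) f p q r
    (M : 'M[A]_(p, q)) (N : 'M[A]_(q, r)) :
  is_ideal J -> regular_mod J f -> mx_in J (M *m N) -> exact_mod J M N ->
  saturated_image J f M.
Proof.
move=> idJ regf JMN exMN v w Jvw; apply: exMN => i j; apply: regf.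
have := mx_inB idJ (mx_in_mull v idJ JMN) (mx_in_mulr N idJ Jvw).
by move/(_ i j); rewrite mulmxBl mulmxA opprB addrC subrK -scalemxAl mxE.
Qed.

(** Exactness survives reduction modulo [f] when [f] is regular on the cokernel of
the next map: if [v N = f w] modulo [J], then [w] is itself in the image of [N],
and [v] can be corrected by a multiple of [f]. *)
Lemma exact_mod_adjoin (A : comNzRingType) (J : A -> Prop) f p q r
    (M : 'M[A]_(p, q)) (N : 'M[A]_(q, r)) :
  is_ideal J -> exact_mod J M N -> saturated_image J f N ->
  exact_mod (adjoin J f) M N.
Proof.
move=> idJ exMN satN v /(mx_in_adjoin idJ) [w Jvw].
have [u Ju] := satN _ _ Jvw.
have /exMN [t Jt] : mx_in J ((v - f *: u) *m N).
  rewrite mulmxBl -scalemxAl.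
  rewrite (_ : _ - _ = (v *m N - f *: w) + f *: (w - u *m N)); last first.
    by rewrite scalerBr addrA subrK.
  by apply: mx_inD => //; apply: mx_inZ.
by exists t; apply: (@adjoin_mx_in _ _ _ _ _ _ u); rewrite addrAC.
Qed.

(** Only the map at the right end needs a hypothesis of its own: at every other
place [exact_saturated] supplies the regularity on the cokernel. *)
Lemma exact_complex_adjoin (A : comNzRingType) (J : A -> Prop) f (n : nat -> nat)
    (d : forall i, 'M[A]_(n i.+1, n i)) :
  is_ideal J -> regular_mod J f -> (forall i, d i.+1 *m d i = 0) ->
  saturated_image J f (d 0%N) -> (forall i, exact_mod J (d i.+1) (d i)) ->
  forall i, exact_mod (adjoin J f) (d i.+1) (d i).
Proof.
move=> idJ regf dd sat0 exd [|i]; apply: exact_mod_adjoin => //.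
apply: exact_saturated (exd i) => //.
by rewrite dd => i1 j; rewrite mxE; case: idJ.
Qed.

Lemma resolution_complex (k : fieldType) (I : bipoly k -> Prop) Fs delta :
  @minimal_resolution k I Fs delta -> forall i, delta i.+1 *m delta i = 0.
Proof.
move=> res i; apply/row_matrixP => r; rewrite row0 row_mul.
by apply/(res_exact res); exists (delta_mx 0 r); rewrite -rowE.
Qed.

(** This is the vanishing of [Tor_i(R/I, R/(x, y))] for positive [i], when [(x, y)]
is a regular sequence on both [R] and [R/I]. *)
Lemma resolution_exact_mod (k : fieldType) (I : bipoly k -> Prop) Fs delta
    (x y : bipoly k) :
  @minimal_resolution k I Fs delta -> is_ideal I ->
  regular_mod (@zero_ideal _) x -> regular_mod (adjoin (@zero_ideal _) x) y ->
  regular_mod I x -> regular_mod (adjoin I x) y ->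
  forall i, exact_mod (adjoin (adjoin (@zero_ideal _) x) y) (delta i.+1) (delta i).
Proof.
move=> res idI regx regy regIx regIy.
have id0 := @zero_ideal_ideal (bipoly k).
have dd := resolution_complex res.
have rowK (w : 'rV[bipoly k]_1) : w = (w 0 0)%:M by rewrite [LHS]mx11_scalar.
apply: (@exact_complex_adjoin _ _ _ (fun i => size (res_module Fs i))) => //.
- exact: adjoin_ideal.
- move=> v w Jvw; rewrite /= in v w Jvw *.
  have /adjoinP-/(_ idI) [t It] : adjoin I x (w 0 0).
    apply: regIy; have /adjoinP-/(_ id0) [t Jt] := Jvw 0 0.
    apply/adjoinP => //; exists (- t); apply/(res_augmentation res).
    exists v; rewrite [LHS]rowK; congr (_%:M).
    by apply/eqP; rewrite -subr_eq0 -[X in _ == X]Jt !mxE; apply/eqP; ring.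
  have [u Ju] := (res_augmentation res _).1 It.
  exists u => i j; rewrite !ord1; apply/adjoinP => //; exists t.
  by rewrite mxE [X in _ + X - _]mxE Ju /zero_ideal !mxE /=; ring.
apply: (@exact_complex_adjoin _ _ _ (fun i => size (res_module Fs i))) => //.
- move=> v w /zero_ideal_mx /eqP; rewrite subr_eq0 => /eqP Jvw.
  rewrite /= in v w Jvw *.
  have /(res_augmentation res) [u Ju] : I (w 0 0).
    apply: regIx; apply/(res_augmentation res); exists v.
    by rewrite Jvw [LHS]rowK mxE.
  by exists u; apply/zero_ideal_mx; rewrite Ju -rowK subrr.
- move=> i v /zero_ideal_mx /(res_exact res) [w <-].
  by exists w; apply/zero_ideal_mx; rewrite subrr.
Qed.

(** * Bihomogeneous components *)

(** Bihomogeneous components are obtained by selecting monomials. A general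
selection predicate makes it possible to select by [mbideg m + e == d], which
needs no subtraction of bidegrees. *)
Definition mfilter n (k : fieldType) (p : pred 'X_{1..n}) (f : {mpoly k[n]}) :
    {mpoly k[n]} :=
  \sum_(m <- msupp f | p m) f@_m *: 'X_[m].

Lemma mcoeff_mfilter n (k : fieldType) (p : pred 'X_{1..n})
    (f : {mpoly k[n]}) m :
  (mfilter p f)@_m = if p m then f@_m else 0.
Proof.
rewrite /mfilter raddf_sum /=.
have [mf|mf] := boolP (m \in msupp f); last first.
  rewrite big_seq_cond big1 => [|m' /andP[m'f _]].
    by move: mf; rewrite -mcoeff_eq0 => /eqP ->; rewrite if_same.
  rewrite mcoeffZ mcoeffX (_ : _ == _ = false) ?mulr0 //.
  by apply: contraNF mf => /eqP <-.
rewrite -big_filter; case: ifP => pm.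
  rewrite (bigD1_seq m) ?filter_uniq ?msupp_uniq ?mem_filter ?pm //=.
  rewrite mcoeffZ mcoeffX eqxx mulr1 big1 ?addr0 // => m' /negPf m'm.
  by rewrite mcoeffZ mcoeffX m'm mulr0.
rewrite big_seq big1 // => m'; rewrite mem_filter => /andP[pm' _].
rewrite mcoeffZ mcoeffX (_ : _ == _ = false) ?mulr0 //.
by apply: contraTF pm' => /eqP ->; rewrite pm.
Qed.

Lemma msupp_mfilter n (k : fieldType) (p : pred 'X_{1..n}) (f : {mpoly k[n]}) m :
  m \in msupp (mfilter p f) -> p m /\ m \in msupp f.
Proof.
by rewrite !mcoeff_msupp mcoeff_mfilter; case: ifP => //; rewrite eqxx.
Qed.

Lemma mfilter_sum n (k : fieldType) (p : pred 'X_{1..n}) (I : Type) (r : seq I)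
    (F : I -> {mpoly k[n]}) :
  mfilter p (\sum_(i <- r) F i) = \sum_(i <- r) mfilter p (F i).
Proof.
apply/mpolyP => m; rewrite mcoeff_mfilter !raddf_sum /=.
by case: ifP => pm; [|rewrite big1 //]; try apply: eq_bigr; move=> i _;
  rewrite mcoeff_mfilter pm.
Qed.

(** A homogeneous factor shifts the degree to be selected; the relation between [p]
and [q] expresses the shift. *)
Lemma mfilterM n (k : fieldType) (p q : pred 'X_{1..n}) (f h : {mpoly k[n]}) :
  (forall m1 m2, m2 \in msupp h -> p (m1 + m2)%MM = q m1) ->
  mfilter p (f * h) = mfilter q f * h.
Proof.
move=> pq; apply/mpolyP => m; rewrite mcoeff_mfilter !mcoeffM.
transitivity (\sum_(l : 'X_{1..n < (mdeg m).+1, (mdeg m).+1}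
    | m == (l.1 + l.2)%MM) (if p m then f@_l.1 * h@_l.2 else 0)).
  by case: ifP => // _; rewrite big1.
apply: eq_bigr => l /eqP /(congr1 p) ->; rewrite mcoeff_mfilter.
have [lh|] := boolP ((l.2 : 'X_{1..n}) \in msupp h).
  by rewrite pq //; case: ifP; rewrite ?mul0r.
by rewrite -mcoeff_eq0 => /eqP ->; rewrite !mulr0 if_same.
Qed.

Lemma mfilter_id n (k : fieldType) (p : pred 'X_{1..n}) (f : {mpoly k[n]}) :
  (forall m, m \in msupp f -> p m) -> mfilter p f = f.
Proof.
move=> pf; apply/mpolyP => m; rewrite mcoeff_mfilter; case: ifP => // pm.
apply/esym/eqP; rewrite mcoeff_eq0; apply/negP => /pf; rewrite pm //.
Qed.

Lemma bidegreeP (d e : bidegree) : d.1 = e.1 -> d.2 = e.2 -> d = e.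
Proof. by case: d e => [? ?] [? ?] /= -> ->. Qed.

Lemma bidegree_addrI (d : bidegree) : injective (+%R d).
Proof. by case: d => a b [c1 c2] [d1 d2] [/addnI -> /addnI ->]. Qed.

Lemma mbidegD (m1 m2 : 'X_{1..2 + 2}) : mbideg (m1 + m2)%MM = mbideg m1 + mbideg m2.
Proof.
by apply: bidegreeP => /=; rewrite -big_split; apply: eq_bigr => i _; rewrite mnmDE.
Qed.

Definition part (k : fieldType) (d : bidegree) (f : bipoly k) : bipoly k :=
  mfilter (fun m => mbideg m == d) f.

Lemma part_bihomogeneous (k : fieldType) d (f : bipoly k) : bihomogeneous d (part d f).
Proof. by move=> m /msupp_mfilter [/eqP]. Qed.

Lemma partM (k : fieldType) d e (f h : bipoly k) :
  bihomogeneous e h -> part (e + d) (f * h) = part d f * h.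
Proof.
move=> hh; apply: mfilterM => m1 m2 /hh e2.
by rewrite mbidegD e2 addrC (inj_eq (@bidegree_addrI e)).
Qed.

Lemma sum_parts (k : fieldType) (f : bipoly k) :
  f = \sum_(d <- undup (map mbideg (msupp f))) part d f.
Proof.
apply/mpolyP => m; rewrite raddf_sum /=.
have [mf|] := boolP (m \in msupp f); last first.
  rewrite -mcoeff_eq0 => /eqP m0; rewrite m0 big1 // => d _.
  by rewrite mcoeff_mfilter m0 if_same.
rewrite (bigD1_seq (mbideg m)) ?undup_uniq ?mem_undup ?map_f //=.
rewrite mcoeff_mfilter eqxx big1 ?addr0 // => d /negPf dm.
by rewrite mcoeff_mfilter eq_sym dm.
Qed.

Lemma ideal_parts (k : fieldType) (J : bipoly k -> Prop) (f : bipoly k) :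
  is_ideal J -> (forall d, J (part d f)) -> J f.
Proof. by move=> idJ Jf; rewrite (sum_parts f); apply: is_ideal_sum. Qed.

Lemma bihomogeneousM (k : fieldType) d e (f g : bipoly k) :
  bihomogeneous d f -> bihomogeneous e g -> bihomogeneous (d + e) (f * g).
Proof.
move=> hf hg m /msuppM_le /allpairsP [[m1 m2] [/= /hf d1 /hg d2 ->]].
by rewrite mbidegD d1 d2.
Qed.

Lemma bihomogeneousD (k : fieldType) d (f g : bipoly k) :
  bihomogeneous d f -> bihomogeneous d g -> bihomogeneous d (f + g).
Proof. by move=> hf hg m /msuppD_le; rewrite mem_cat => /orP[/hf|/hg]. Qed.

Lemma bihomogeneousN (k : fieldType) d (f : bipoly k) :
  bihomogeneous d f -> bihomogeneous d (- f).
Proof. by move=> hf m; rewrite (perm_mem (msuppN f)); apply: hf. Qed.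

Lemma bihomogeneousC (k : fieldType) (c : k) : bihomogeneous 0 (c%:MP : bipoly k).
Proof.
move=> m; rewrite msuppC; case: ifP => // _; rewrite inE => /eqP ->.
by apply: bidegreeP => /=; apply: big1 => i _; rewrite mnmE.
Qed.

Lemma bihomogeneousCM (k : fieldType) d (c : k) (f : bipoly k) :
  bihomogeneous d f -> bihomogeneous d (c%:MP * f).
Proof.
by move=> hf; rewrite -[d]add0r; apply: bihomogeneousM => //; apply: bihomogeneousC.
Qed.

Lemma bihomogeneousX (k : fieldType) d (f : bipoly k) n :
  bihomogeneous d f -> bihomogeneous (d *+ n) (f ^+ n).
Proof.
move=> hf; elim: n => [|n IHn]; last by rewrite exprS mulrS; apply: bihomogeneousM.
by rewrite mulr0n expr0 -mpolyC1; apply: bihomogeneousC.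
Qed.

(** * Variables, linear forms and substitutions *)

(** The boolean selects a factor of the product of projective lines: [false] for
the variables [x_j], [true] for the variables [y_j]. *)
Definition var_index (b : bool) (j : 'I_2) : 'I_(2 + 2) :=
  if b then rshift 2 j else lshift 2 j.

Definition bvar (k : fieldType) (b : bool) (j : 'I_2) : bipoly k := 'X_(var_index b j).
Arguments bvar {k}.

Definition bunit (b : bool) : bidegree := if b then (0, 1)%N else (1, 0)%N.

Lemma var_indexP (i : 'I_(2 + 2)) : exists b j, i = var_index b j.
Proof.
case: (split_ordP i) => j ->; first by exists false, j.
by exists true, j.
Qed.

Lemma bvar_bihomogeneous (k : fieldType) b j : bihomogeneous (bunit b) (@bvar k b j).
Proof.
move=> m; rewrite msuppX inE => /eqP ->; rewrite /mbideg.
by case: j => [[|[|//]] ij]; case: b; apply: bidegreeP;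
  rewrite /= !big_ord_recl big_ord0 !mnm1E.
Qed.

Definition pt_coord (k : fieldType) (b : bool) (P : P1xP1 k) (j : 'I_2) : k :=
  val (repr (if b then P.2 else P.1)) 0 j.

Lemma eval_bvar (k : fieldType) (P : P1xP1 k) b j :
  eval_at (bvar b j) P = pt_coord b P j.
Proof. by rewrite /eval_at mevalXU /coords; case: b; rewrite ?row_mxEl ?row_mxEr. Qed.

Lemma ord2P (j : 'I_2) : j = 0 \/ j = 1.
Proof. by case: j => [[|[|//]] ij]; [left|right]; apply: val_inj. Qed.

Lemma pt_coord_neq0 (k : fieldType) b (P : P1xP1 k) :
  pt_coord b P 0 != 0 \/ pt_coord b P 1 != 0.
Proof.
apply/orP; rewrite -negb_and; apply: contra (valP (repr (if b then P.2 else P.1))).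
move=> /andP[/eqP P0 /eqP P1]; apply/eqP/rowP => j; rewrite mxE.
by case: (ord2P j) => ->.
Qed.

(** The linear form whose zeros on factor [b] are the component of [P]. *)
Definition point_form (k : fieldType) (b : bool) (P : P1xP1 k) : bipoly k :=
  (pt_coord b P 0)%:MP * bvar b 1 - (pt_coord b P 1)%:MP * bvar b 0.

(** With [c] general, this form vanishes at no point of a given finite set. *)
Definition gen_form (k : fieldType) (b : bool) (c : k) : bipoly k :=
  bvar b 0 + c%:MP * bvar b 1.

Lemma point_form_bihomogeneous (k : fieldType) b (P : P1xP1 k) :
  bihomogeneous (bunit b) (point_form b P).
Proof.
by apply: bihomogeneousD; [|apply: bihomogeneousN]; apply: bihomogeneousCM;
  apply: bvar_bihomogeneous.
Qed.

Lemma gen_form_bihomogeneous (k : fieldType) b (c : k) :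
  bihomogeneous (bunit b) (gen_form b c).
Proof.
by apply: bihomogeneousD; [|apply: bihomogeneousCM]; apply: bvar_bihomogeneous.
Qed.

Lemma eval_point_form (k : fieldType) b (P : P1xP1 k) : eval_at (point_form b P) P = 0.
Proof.
rewrite /point_form /eval_at rmorphB !rmorphM /= !mevalC.
by rewrite -!/(eval_at _ _) !eval_bvar mulrC subrr.
Qed.

Lemma eval_gen_form (k : fieldType) b (c : k) (P : P1xP1 k) :
  eval_at (gen_form b c) P = pt_coord b P 0 + c * pt_coord b P 1.
Proof.
by rewrite /eval_at rmorphD rmorphM /= mevalC -!/(eval_at _ _) !eval_bvar.
Qed.

Lemma irrelevant_ideal_ideal (k : fieldType) : is_ideal (@irrelevant_ideal k).
Proof. exact: ideal_gen_ideal. Qed.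

Lemma irrelevant_sub (k : fieldType) (J : bipoly k -> Prop) :
  is_ideal J -> (forall b j, J (bvar b j)) -> forall f, irrelevant_ideal f -> J f.
Proof.
move=> idJ Jvar; apply: ideal_gen_sub => // _ [i ->].
by have [b [j ->]] := var_indexP i; apply: Jvar.
Qed.

Definition subst_tuple (k : fieldType) (h : bool -> 'I_2 -> bipoly k) :
    (2 + 2).-tuple (bipoly k) :=
  [tuple match split i with inl j => h false j | inr j => h true j end | i < 2 + 2].

Notation subst h f := (f \mPo subst_tuple h).

Lemma subst_bvar (k : fieldType) (h : bool -> 'I_2 -> bipoly k) b j :
  subst h (bvar b j) = h b j.
Proof.
rewrite comp_mpolyXU -tnth_nth tnth_mktuple /var_index.
by case: b; [rewrite (unsplitK (inr j))|rewrite (unsplitK (inl j))].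
Qed.

Lemma subst_congr (k : fieldType) (J : bipoly k -> Prop) h :
  is_ideal J -> (forall b j, J (bvar b j - h b j)) -> forall f, J (f - subst h f).
Proof.
move=> idJ Jh f; have [J0 JD JM] := idJ.
have mulJ f1 g1 f2 g2 : J (f1 - g1) -> J (f2 - g2) -> J (f1 * f2 - g1 * g2).
  move=> Ju Jv; rewrite (_ : _ - _ = f2 * (f1 - g1) + g1 * (f2 - g2)); last by ring.
  by apply: JD; apply: JM.
rewrite comp_mpolyEX {1}[f]mpolyE -sumrB; apply: is_ideal_sum => // m _.
rewrite -scalerBr -mul_mpolyC; apply: JM; rewrite comp_mpolyX mpolyXE_id.
apply: (big_ind2 (fun a b => J (a - b))) => [|a1 b1 a2 b2|i _]; rewrite ?subrr //.
  exact: mulJ.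
have [b [j ->]] := var_indexP i.
have Jbj : J ('X_(var_index b j) - tnth (subst_tuple h) (var_index b j)).
  have := Jh b j; rewrite -(subst_bvar h) /bvar comp_mpolyXU -tnth_nth //.
elim: (m _) => [|n IHn]; first by rewrite !expr0 subrr.
by rewrite !exprS; apply: mulJ.
Qed.

(** If the variables are congruent to their substitutes modulo [J] and [J] is killed
by the substitution, then [J] is its kernel. This presents the ideals generated by
linear forms as kernels of maps to an integral domain, hence as prime ideals, and
regularity modulo them becomes the nonvanishing of an image ([kernel_regular]). *)
Lemma mem_kernel (k : fieldType) (J : bipoly k -> Prop) h :
  is_ideal J -> (forall b j, J (bvar b j - h b j)) ->
  (forall f, J f -> subst h f = 0) -> forall f, J f <-> subst h f = 0.
Proof.
move=> idJ Jh J0 f; split=> [/J0 //|f0].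
by have := subst_congr idJ Jh f; rewrite f0 subr0.
Qed.

Lemma kernel_regular (k : fieldType) (J : bipoly k -> Prop) h g :
  is_ideal J -> (forall b j, J (bvar b j - h b j)) ->
  (forall f, J f -> subst h f = 0) -> subst h g != 0 -> regular_mod J g.
Proof.
move=> idJ Jh J0 g0 f /(mem_kernel idJ Jh J0); rewrite rmorphM /= => /eqP.
by rewrite mulf_eq0 (negPf g0) => /eqP /(mem_kernel idJ Jh J0).
Qed.

Lemma adjoin_kernel (k : fieldType) (J : bipoly k -> Prop) h g :
  is_ideal J -> (forall f, J f -> subst h f = 0) -> subst h g = 0 ->
  forall f, adjoin J g f -> subst h f = 0.
Proof.
move=> idJ J0 g0 f /adjoinP-/(_ idJ) [t /J0]; rewrite rmorphB rmorphM /= g0 mulr0 subr0.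
by [].
Qed.

Lemma irrelevantP (k : fieldType) (f : bipoly k) : irrelevant_ideal f <-> f@_0%MM = 0.
Proof.
have irr := @irrelevant_ideal_ideal k.
have -> : f@_0%MM = 0 <-> subst (fun _ _ => 0) f = 0.
  rewrite (_ : subst _ f = (f@_0%MM)%:MP).
    by split=> [->|/eqP]; rewrite ?mpolyC0 // mpolyC_eq0 => /eqP.
  rewrite comp_mpolyEX.
  rewrite (eq_bigr (fun m => if m == 0%MM then (f@_0%MM)%:MP else 0)) => [|m _].
    have [f0|] := boolP (0%MM \in msupp f); last first.
      rewrite -mcoeff_eq0 => /eqP ->; rewrite mpolyC0 big1 // => m _.
      by rewrite if_same.
    rewrite -big_mkcond -big_filter (bigD1_seq 0%MM) ?filter_uniq ?msupp_uniq //=.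
      rewrite big_filter_cond big1 ?addr0 // => m /andP[/eqP -> /eqP //].
    by rewrite mem_filter eqxx.
  case: eqP => [->|/eqP m0]; first by rewrite mpolyX0 comp_mpoly1 -mul_mpolyC mulr1.
  rewrite comp_mpolyX.
  have [i mi] : exists i, m i != 0%N.
    apply/existsP; apply: contraNT m0 => /existsPn m0.
    by apply/eqP/mnmP => i; rewrite mnm0E; apply/eqP; rewrite -[_ == _]negbK m0.
  rewrite (bigD1 i) //= tnth_mktuple (_ : match _ with inl _ => _ | _ => _ end = 0);
    last by case: (split i).
  by rewrite expr0n (negPf mi) mul0r scaler0.
apply: mem_kernel => // [b j|].
  by rewrite subr0; apply: ideal_gen_mem; exists (var_index b j).
apply: (ideal_gen_sub (J := fun f => subst _ f = 0)).
  by split=> [|u v u0 v0|u v v0];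
    rewrite ?rmorph0 ?rmorphD ?rmorphM /= ?u0 ?v0 ?addr0 ?mulr0.
by move=> _ [i ->]; have [b [j ->]] := var_indexP i; apply: subst_bvar.
Qed.

Lemma bvar_irrelevant (k : fieldType) b j : irrelevant_ideal (@bvar k b j).
Proof. by apply: ideal_gen_mem; exists (var_index b j). Qed.

Lemma linear_irrelevant (k : fieldType) b (f : bipoly k) :
  bihomogeneous (bunit b) f -> irrelevant_ideal f.
Proof.
move=> hf; apply/irrelevantP/eqP; rewrite mcoeff_eq0; apply/negP => /hf.
by rewrite /mbideg !big1 => [|i _|i _]; rewrite ?mnm0E //; case: b {hf}.
Qed.

Lemma one_not_irrelevant (k : fieldType) : ~ irrelevant_ideal (1 : bipoly k).
Proof. by move=> /irrelevantP /eqP; rewrite mcoeff1 eqxx oner_eq0. Qed.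

(** * Ideals of points and their depth *)

Lemma eval_atM (k : fieldType) (f g : bipoly k) P :
  eval_at (f * g) P = eval_at f P * eval_at g P.
Proof. exact: rmorphM. Qed.

Lemma eval_atB (k : fieldType) (f g : bipoly k) P :
  eval_at (f - g) P = eval_at f P - eval_at g P.
Proof. exact: rmorphB. Qed.

Lemma eval_atC (k : fieldType) (c : k) P : eval_at (c%:MP : bipoly k) P = c.
Proof. exact: mevalC. Qed.

Lemma eval_at_sum (k : fieldType) (I : Type) (r : seq I) (F : I -> bipoly k) P :
  eval_at (\sum_(i <- r) F i) P = \sum_(i <- r) eval_at (F i) P.
Proof. exact: raddf_sum. Qed.

Lemma ideal_of_points_ideal (k : fieldType) (Y : {fset P1xP1 k}) :
  is_ideal (ideal_of_points Y).
Proof. exact: ideal_gen_ideal. Qed.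

Lemma ideal_of_points_form (k : fieldType) (Y : {fset P1xP1 k}) d f :
  bihomogeneous d f -> (forall Q, Q \in Y -> eval_at f Q = 0) ->
  ideal_of_points Y f.
Proof. by move=> hf f0; apply: ideal_gen_mem; split; [exists d|]. Qed.

(** The ideal of a set of points is bigraded, so membership is tested by evaluating
the components; a general polynomial in the ideal need not be a form. *)
Lemma ideal_of_pointsP (k : fieldType) (Y : {fset P1xP1 k}) f :
  ideal_of_points Y f <-> forall d Q, Q \in Y -> eval_at (part d f) Q = 0.
Proof.
split=> [[n [g [h [Yh ->]]]] d Q QY|f0]; last first.
  apply: ideal_parts => [|d]; first exact: ideal_of_points_ideal.
  exact: (ideal_of_points_form (@part_bihomogeneous k d f) (f0 d)).
rewrite /part mfilter_sum eval_at_sum big1 // => i _.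
have [[e he] h0] := Yh i.
rewrite (mfilterM (q := fun m => mbideg m + e == d)); last first.
  by move=> m1 m2 /he <-; rewrite mbidegD.
by rewrite eval_atM h0 // mulr0.
Qed.

Lemma colon_ideal (A : comNzRingType) (J : A -> Prop) (g : A) :
  is_ideal J -> is_ideal (fun t => J (t * g)).
Proof.
case=> J0 JD JM; split=> [|u v|a u]; rewrite ?mul0r ?mulrDl -?mulrA //.
  exact: JD.
exact: JM.
Qed.

Lemma ideal_of_points_colon (k : fieldType) (Y : {fset P1xP1 k}) e g t :
  bihomogeneous e g ->
  ideal_of_points Y (t * g) <->
  forall d Q, Q \in Y -> eval_at (part d t) Q * eval_at g Q = 0.
Proof.
move=> hg; split=> [/ideal_of_pointsP tg d Q QY|tg].
  by rewrite -eval_atM -(partM d t hg) tg.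
have idY := ideal_of_points_ideal Y.
apply: (ideal_parts (colon_ideal g idY)) => d.
apply: (@ideal_of_points_form _ _ (d + e)) => [|Q QY].
  by apply: bihomogeneousM => //; apply: part_bihomogeneous.
by rewrite eval_atM tg.
Qed.

(** A form with a nonzero constant term is constant, and a constant that vanishes at
a point is zero. *)
Lemma ideal_of_points_irrelevant (k : fieldType) (Y : {fset P1xP1 k}) Q f :
  Q \in Y -> ideal_of_points Y f -> irrelevant_ideal f.
Proof.
move=> QY; apply: ideal_gen_sub => [|h [[d hd] /(_ Q QY) hQ]].
  exact: irrelevant_ideal_ideal.
apply/irrelevantP/eqP; rewrite mcoeff_eq0; apply/negP => h0.
have d0 : d = (0, 0)%N.
  by rewrite -(hd _ h0); apply: bidegreeP; apply: big1 => i _; rewrite mnm0E.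
suff hC : h = (h@_0%MM)%:MP.
  by move: hQ h0; rewrite hC eval_atC => ->; rewrite mpolyC0 msupp0.
apply/mpolyP => m; rewrite mcoeffC; have [->|m0] := eqVneq m 0%MM; first by rewrite mulr1.
rewrite mulr0; apply/eqP; rewrite mcoeff_eq0; apply: contra m0 => /hd.
rewrite d0 => -[/eqP m1 /eqP m2]; apply/eqP/mnmP => i; rewrite mnm0E; apply/eqP.
move: m1 m2; rewrite !sum_nat_eq0 => /forallP /= m1 /forallP /= m2.
by have [[] [j ->]] := var_indexP i; [apply: m2|apply: m1].
Qed.

Definition avoids (k : fieldType) (b : bool) (c : k) (Y : {fset P1xP1 k}) : Prop :=
  forall Q, Q \in Y -> eval_at (gen_form b c) Q != 0.

Lemma exists_avoids (k : closedFieldType) (b : bool) (Y : {fset P1xP1 k}) :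
  exists c : k, avoids b c Y.
Proof.
(* p is the product, over the points, of their values on x0 + c x1 seen as
   polynomials in c; a non-root is a suitable parameter. *)
pose p := \prod_(Q <- Y) ((pt_coord b Q 0)%:P + pt_coord b Q 1 *: 'X : {poly k}).
have /closed_nonrootP [c pc] : p != 0.
  rewrite prodf_seq_neq0; apply/allP => Q _ /=.
  apply/negP => /eqP /polyP pQ.
  have := pQ 0%N; have := pQ 1%N.
  rewrite !coefD !coefZ !coefC !coefX /= mulr1 mulr0 add0r addr0 => Q1 Q0.
  by case: (pt_coord_neq0 b Q) => /eqP; rewrite ?Q0 ?Q1.
exists c => Q QY; rewrite eval_gen_form.
move: pc; rewrite rootE horner_prod prodf_seq_neq0 => /allP /(_ Q QY) /=.
by rewrite hornerD hornerC hornerZ hornerX mulrC.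
Qed.

Lemma gen_form_regular (k : fieldType) b (c : k) (Y : {fset P1xP1 k}) :
  avoids b c Y -> regular_mod (ideal_of_points Y) (gen_form b c).
Proof.
move=> avY g; rewrite mulrC.
move=> /(ideal_of_points_colon _ _ (@gen_form_bihomogeneous k b c)) gY.
apply/ideal_of_pointsP => d Q QY; apply/eqP.
by have /eqP := gY d Q QY; rewrite mulf_eq0 (negPf (avY _ QY)) orbF.
Qed.

(** Modulo the form [gen_form b c] each [point_form b Q] is a nonzero multiple of
the variable [bvar b 1], as [gen_form b c] does not vanish at [Q]. The product of
these forms over the points [Q] of [Y] lies in the ideal of [Y]. *)
Lemma last_var_nilpotent (k : fieldType) b (c : k) (Y : {fset P1xP1 k}) :
  avoids b c Y -> exists r, adjoin (ideal_of_points Y) (gen_form b c) (bvar b 1 ^+ r).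
Proof.
move=> avY; have idY := ideal_of_points_ideal Y.
suff [r [d [g [hg gY [t gt]]]]] : exists r d g, [/\ bihomogeneous d g,
    forall Q, Q \in (Y : seq _) -> eval_at g Q = 0 &
    exists t, bvar b 1 ^+ r - g = t * gen_form b c].
  exists r; apply/adjoinP => //; exists t.
  by rewrite -gt opprB addrCA subrr addr0; apply: ideal_of_points_form hg gY.
have : {subset (Y : seq _) <= Y} by [].
elim: (Y : seq _) => [|Q s IHs] sY.
  exists 0%N, 0, 1; split=> //; last by exists 0; rewrite expr0 subrr mul0r.
  by rewrite -mpolyC1; apply: bihomogeneousC.
have [|r [d [g [hg gs [t gt]]]]] := IHs.
  by move=> R Rs; apply: sY; rewrite inE Rs orbT.
have Q0 := avY Q (sY Q (mem_head _ _)); rewrite eval_gen_form in Q0.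
set u := _ + _ in Q0.
exists r.+1, (bunit b + d), (u^-1%:MP * point_form b Q * g); split.
- by apply: bihomogeneousM => //; apply: bihomogeneousCM; apply: point_form_bihomogeneous.
- move=> R; rewrite inE eval_atM => /predU1P [->|/gs ->]; last by rewrite mulr0.
  by rewrite eval_atM eval_point_form mulr0 mul0r.
- exists (u^-1%:MP * (pt_coord b Q 1)%:MP * g + bvar b 1 * t).
  have LQ : u^-1%:MP * point_form b Q =
      bvar b 1 - u^-1%:MP * (pt_coord b Q 1)%:MP * gen_form b c.
    rewrite -[in RHS](mul1r (bvar b 1)) -mpolyC1 -(mulVf Q0) mpolyCM -!mulrA -mulrBr.
    by congr (_ * _); rewrite /u mpolyCD mpolyCM /point_form /gen_form; ring.
  rewrite mulrDl -[_ * t * _]mulrA -gt LQ exprS; ring.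
Qed.

(** The two general forms and the last variable of each factor generate the
irrelevant ideal. *)
Lemma irrelevant_colon (k : fieldType) (N : bipoly k -> Prop) (c e : k) n :
  is_ideal N -> N (gen_form false c * n) -> N (gen_form true e * n) ->
  N (bvar false 1 * n) -> N (bvar true 1 * n) ->
  forall z, irrelevant_ideal z -> N (z * n).
Proof.
move=> idN Nc Ne N0 N1; have [_ _ NM] := idN.
apply: (irrelevant_sub (colon_ideal n idN)) => b j.
have [->|->] := ord2P j; last by case: b.
have gen b' a : bvar b' 0 = gen_form b' a - a%:MP * bvar b' 1 :> bipoly k.
  by rewrite /gen_form addrK.
by case: b; [rewrite (gen true e)|rewrite (gen false c)];
  rewrite mulrBl -mulrA; apply: is_idealB => //; apply: NM.
Qed.

(** If [gen_form true e] were a zero divisor modulo [N = (I_Y, gen_form false c)],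
killing [n], then by [last_var_nilpotent] powers of the last variables would carry
[n] into [N], and some multiple of [n] would be a nonzero socle element of [R/N];
there is none by [socle_free_exchange]. *)
Lemma depth_two_regular (k : fieldType) (c e : k) (Y : {fset P1xP1 k}) :
  avoids false c Y -> avoids true e Y -> depth_quotient (ideal_of_points Y) 2 ->
  regular_mod (adjoin (ideal_of_points Y) (gen_form false c)) (gen_form true e).
Proof.
move=> avc ave [[s [[irr regs] size_s]] _] n.
case: s irr regs size_s => [|f1 [|f2 [|]]] //= irr [reg1 [reg2 _]] _.
set N := adjoin _ (gen_form false c) => Nn; apply: NNPP => nN.
have idY := ideal_of_points_ideal Y.
have idN : is_ideal N := adjoin_ideal _ _; have [N0 ND NM] := idN.
have [r Nr] := last_var_nilpotent avc.
have [s /adjoinP-/(_ idY) [t Nst]] := last_var_nilpotent ave.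
have [||u [nu Nu Nv]] := socle_of_nilpotents idN nN (u := bvar false 1)
    (v := bvar true 1) (r := r) (s := s).
- exact: is_idealMr.
- rewrite (_ : _ * n = n * (bvar true 1 ^+ s - t * gen_form true e)
    + t * (gen_form true e * n)); last by ring.
  by apply: ND; apply: NM => //; apply: adjoin_sub.
apply: nu; apply: (@socle_free_exchange _ (@irrelevant_ideal k) _ f1 f2) => //.
- by apply: irr; rewrite mem_head.
- by apply: irr; rewrite !inE eqxx orbT.
- exact: gen_form_regular.
apply: (irrelevant_colon (c := c) (e := e)) => //.
  by rewrite mulrC; apply: adjoin_gen.
by rewrite mulrCA; apply: NM.
Qed.

(** The quotient by [(I_Y, gen_form false c, gen_form true e)] is nonzero and the
variables are nilpotent in it, so it has a nonzero socle element; hence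
[no_regular_triple] excludes longer regular sequences. *)
Lemma regular_depth_two (k : fieldType) (c e : k) (Y : {fset P1xP1 k}) Q :
  Q \in Y -> avoids false c Y -> avoids true e Y ->
  regular_mod (adjoin (ideal_of_points Y) (gen_form false c)) (gen_form true e) ->
  depth_quotient (ideal_of_points Y) 2.
Proof.
move=> QY avc ave reg2; have idY := ideal_of_points_ideal Y.
have irr := @irrelevant_ideal_ideal k.
have irrgen b a := linear_irrelevant (@gen_form_bihomogeneous k b a).
pose J := adjoin (adjoin (ideal_of_points Y) (gen_form false c)) (gen_form true e).
have idJ : is_ideal J := adjoin_ideal _ _.
have J1 : ~ J 1.
  suff Jirr f : J f -> irrelevant_ideal f.
    by move=> /Jirr; apply: one_not_irrelevant.
  apply: ideal_gen_sub => // g [|-> //]; apply: ideal_gen_sub => // {}g [|-> //].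
  exact: ideal_of_points_irrelevant QY.
split.
  exists [:: gen_form false c; gen_form true e]; split=> //; split.
    by move=> f; rewrite !inE => /orP[] /eqP ->.
  by split; [apply: gen_form_regular|].
move=> [|f1 [|f2 [|f3 s]]] //= [irrs [reg_1 [reg_2 [reg_3 _]]]]; exfalso.
have [r Nr] := last_var_nilpotent avc.
have [s' Ns] := last_var_nilpotent ave.
have [||u [nu Nu Nv]] := socle_of_nilpotents idJ J1 (u := bvar false 1)
    (v := bvar true 1) (r := r) (s := s').
- by rewrite mulr1; apply: adjoin_sub.
- by rewrite mulr1; apply: adjoin_mono Ns => h; apply: adjoin_sub.
apply: nu; apply: (@no_regular_triple _ (@irrelevant_ideal k) _ f1 f2 f3) => //.
- by apply: irrs; rewrite mem_head.
- by apply: irrs; rewrite !inE eqxx orbT.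
- by apply: irrs; rewrite !inE eqxx !orbT.
- exact: gen_form_regular.
apply: (irrelevant_colon (c := c) (e := e)) => //.
  by rewrite mulrC; apply/adjoin_sub/adjoin_gen.
by rewrite mulrC; apply: adjoin_gen.
Qed.

(** * Ideals generated by linear forms *)

Lemma mcoeff_bvar (k : fieldType) b j b' j' :
  (@bvar k b j)@_U_(var_index b' j') = ((b == b') && (j == j'))%:R.
Proof.
rewrite mcoeffXU; congr (_%:R); congr nat_of_bool.
by case: b b' => [] []; rewrite /var_index ?eq_lshift ?eq_rshift ?eq_lrshift ?eq_rlshift.
Qed.

Lemma mderiv_bvar (k : fieldType) b j b' j' :
  (@bvar k b j)^`M(var_index b' j') = ((b == b') && (j == j'))%:R%:MP.
Proof.
rewrite -mcoeff_bvar mderivX mnm1E mcoeffXU.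
case: eqP => [->|_]; last by rewrite scale0r mpolyC0.
by rewrite -[X in (X - _)%MM]add0m addmK mpolyX0 scale1r mpolyC1.
Qed.

Lemma bvar_neq0 (k : fieldType) b j : @bvar k b j != 0.
Proof.
apply/eqP => /(congr1 (mcoeff U_(var_index b j)%MM)); rewrite mcoeff_bvar mcoeff0 !eqxx.
by move/eqP; rewrite oner_eq0.
Qed.

Lemma gen_form_neq0 (k : fieldType) b c : @gen_form k b c != 0.
Proof.
apply/eqP => /(congr1 (mcoeff U_(var_index b 0%R)%MM)).
rewrite /gen_form mul_mpolyC mcoeffD mcoeffZ !mcoeff_bvar mcoeff0 !eqxx mulr0 addr0.
by move/eqP; rewrite oner_eq0.
Qed.

Lemma point_form_neq0 (k : fieldType) b (P : P1xP1 k) : point_form b P != 0.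
Proof.
apply/eqP => P0; have [] := pt_coord_neq0 b P; apply/negP; rewrite negbK.
  move/(congr1 (mcoeff U_(var_index b 1%R)%MM))/eqP: P0.
  by rewrite /point_form !mul_mpolyC mcoeffB !mcoeffZ !mcoeff_bvar mcoeff0 eqxx mulr0
    subr0 mulr1.
move/(congr1 (mcoeff U_(var_index b 0%R)%MM))/eqP: P0.
by rewrite /point_form !mul_mpolyC mcoeffB !mcoeffZ !mcoeff_bvar mcoeff0 eqxx mulr0
  sub0r mulr1 oppr_eq0.
Qed.

Lemma regular_mod_zero (A : idomainType) (f : A) :
  f != 0 -> regular_mod (@zero_ideal A) f.
Proof. by move=> f0 g /eqP; rewrite mulf_eq0 (negPf f0) => /eqP. Qed.

(** The solution of [gen_form b c = 0] in terms of the last variable. *)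
Definition gen_chart (k : fieldType) (b : bool) (c : k) (j : 'I_2) : bipoly k :=
  if j == 0 then - (c%:MP * bvar b 1) else bvar b 1.

Lemma gen_chart_congr (k : fieldType) (J : bipoly k -> Prop) b c j :
  is_ideal J -> J (gen_form b c) -> J (bvar b j - gen_chart b c j).
Proof.
move=> [J0 _ _] Jg; rewrite /gen_chart; have [->|->] := ord2P j; rewrite /= ?subrr //.
by rewrite opprK.
Qed.

Lemma subst_gen_form (k : fieldType) h b (c : k) :
  subst h (gen_form b c) = h b 0 + c%:MP * h b 1.
Proof. by rewrite rmorphD rmorphM /= comp_mpolyC !subst_bvar. Qed.

Lemma gen_chart_root (k : fieldType) b (c : k) :
  gen_chart b c 0 + c%:MP * gen_chart b c 1 = 0.
Proof. by rewrite /gen_chart /= addNr. Qed.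

Lemma zero_subst (k : fieldType) h (f : bipoly k) : zero_ideal f -> subst h f = 0.
Proof. by move=> ->; rewrite comp_mpoly0. Qed.

(** The quotient of [R] by this ideal is a polynomial ring in the last variables of
the two factors; this is the ring over which resolutions are compared. *)
Definition gen_ideal (k : fieldType) (c e : k) : bipoly k -> Prop :=
  adjoin (adjoin (@zero_ideal _) (gen_form false c)) (gen_form true e).

Lemma gen_form_regular_true (k : fieldType) (c e : k) :
  regular_mod (adjoin (@zero_ideal _) (gen_form false c)) (gen_form true e).
Proof.
have id0 := @zero_ideal_ideal (bipoly k).
apply: (@kernel_regular _ _ (fun b j => if b then bvar b j else gen_chart b c j)).
- exact: adjoin_ideal.
- case=> j.
    by rewrite subrr; have [] := adjoin_ideal (@zero_ideal (bipoly k)) (gen_form false c).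
  apply: gen_chart_congr; first exact: adjoin_ideal.
  by apply: ideal_gen_mem; right.
- apply: adjoin_kernel => //; first exact: zero_subst.
  by rewrite subst_gen_form gen_chart_root.
by rewrite subst_gen_form; apply: gen_form_neq0.
Qed.

Lemma last_var_regular_false (k : fieldType) (c e : k) :
  regular_mod (gen_ideal c e) (bvar false 1).
Proof.
have id0 := @zero_ideal_ideal (bipoly k).
have id1 := adjoin_ideal (@zero_ideal (bipoly k)) (gen_form false c).
apply: (@kernel_regular _ _ (fun b j => gen_chart b (if b then e else c) j)).
- exact: adjoin_ideal.
- case=> j; apply: gen_chart_congr; try exact: adjoin_ideal.
    by apply: ideal_gen_mem; right.
  by apply: adjoin_sub; apply: ideal_gen_mem; right.
- apply: adjoin_kernel => //; first apply: adjoin_kernel => //.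
  + exact: zero_subst.
  + by rewrite subst_gen_form gen_chart_root.
  by rewrite subst_gen_form gen_chart_root.
by rewrite subst_bvar; apply: bvar_neq0.
Qed.

Lemma last_var_regular_true (k : fieldType) (c e : k) :
  regular_mod (adjoin (gen_ideal c e) (bvar false 1)) (bvar true 1).
Proof.
have id0 := @zero_ideal_ideal (bipoly k).
have id1 := adjoin_ideal (@zero_ideal (bipoly k)) (gen_form false c).
have id2 : is_ideal (gen_ideal c e) := adjoin_ideal _ _.
have id3 := adjoin_ideal (gen_ideal c e) (bvar false 1).
have J1 : adjoin (gen_ideal c e) (bvar false 1) (bvar false 1).
  by apply: ideal_gen_mem; right.
apply: (@kernel_regular _ _ (fun b j => if b then gen_chart b e j else 0)) => //.
- case=> j.
    by apply: gen_chart_congr => //; apply: adjoin_sub; apply: ideal_gen_mem; right.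
  rewrite subr0; have [->|-> //] := ord2P j.
  have -> : bvar false 0 = gen_form false c - c%:MP * bvar false 1 by rewrite addrK.
  case: (id3) => _ _ JM; apply: is_idealB; [exact: id3| |exact: JM].
  by do 2!apply: adjoin_sub; apply: ideal_gen_mem; right.
- rewrite /gen_ideal in id2 *; apply: adjoin_kernel => //;
    first apply: adjoin_kernel => //; first apply: adjoin_kernel => //.
  + exact: zero_subst.
  + by rewrite subst_gen_form mulr0 addr0.
  + by rewrite subst_gen_form gen_chart_root.
  + by rewrite subst_bvar.
by rewrite subst_bvar; apply: bvar_neq0.
Qed.

Definition point_ideal (k : fieldType) (P : P1xP1 k) : bipoly k -> Prop :=
  adjoin (adjoin (@zero_ideal _) (point_form false P)) (point_form true P).

(** Modulo [point_form b P] the variables of factor [b] are the coordinates of [P]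
times a single form [phi]. *)
Lemma dual_form (k : fieldType) b (P : P1xP1 k) : exists phi : bipoly k,
  [/\ bihomogeneous (bunit b) phi, eval_at phi P = 1 &
      forall j, exists t, bvar b j - (pt_coord b P j)%:MP * phi = t * point_form b P].
Proof.
have CV (c : k) (f : bipoly k) : c != 0 -> c%:MP * (c^-1%:MP * f) = f.
  by move=> c0; rewrite mulrA -mpolyCM mulfV // mpolyC1 mul1r.
have form_i i : bihomogeneous (bunit b) ((pt_coord b P i)^-1%:MP * bvar b i).
  by apply: bihomogeneousCM; apply: bvar_bihomogeneous.
have [Pn|Pn] := pt_coord_neq0 b P.
  exists ((pt_coord b P 0)^-1%:MP * bvar b 0); split=> // [|j].
    by rewrite eval_atM eval_atC eval_bvar mulVf.
  have [->|->] := ord2P j; first by exists 0; rewrite CV // subrr mul0r.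
  exists (pt_coord b P 0)^-1%:MP.
  by rewrite /point_form mulrBr [X in _ = X - _]mulrCA CV // [X in _ = _ - X]mulrCA.
exists ((pt_coord b P 1)^-1%:MP * bvar b 1); split=> // [|j].
  by rewrite eval_atM eval_atC eval_bvar mulVf.
have [->|->] := ord2P j; last by exists 0; rewrite CV // subrr mul0r.
exists (- (pt_coord b P 1)^-1%:MP).
rewrite /point_form mulNr mulrBr opprB [X in _ = X - _]mulrCA CV //.
by rewrite [X in _ = _ - X]mulrCA.
Qed.

Lemma point_forms_regular (k : fieldType) (P : P1xP1 k) :
  regular_mod (adjoin (@zero_ideal _) (point_form false P)) (point_form true P).
Proof.
have id0 := @zero_ideal_ideal (bipoly k).
have [phi [_ _ phiP]] := dual_form false P.
have substP h b : subst h (point_form b P) =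
    (pt_coord b P 0)%:MP * h b 1 - (pt_coord b P 1)%:MP * h b 0.
  by rewrite rmorphB !rmorphM /= !comp_mpolyC !subst_bvar.
apply: (@kernel_regular _ _ (fun b j => if b then bvar b j
    else (pt_coord false P j)%:MP * phi)).
- exact: adjoin_ideal.
- case=> j.
    by rewrite subrr; have [] := adjoin_ideal (@zero_ideal (bipoly k)) (point_form false P).
  by have [t ->] := phiP j; apply: adjoin_gen.
- apply: adjoin_kernel => //; first exact: zero_subst.
  by rewrite substP mulrCA subrr.
by rewrite substP; apply: point_form_neq0.
Qed.

Lemma subst_point (k : fieldType) (P : P1xP1 k) (phi : bool -> bipoly k) d g :
  bihomogeneous d g ->
  subst (fun b j => (pt_coord b P j)%:MP * phi b) g =
    (eval_at g P)%:MP * (phi false ^+ d.1 * phi true ^+ d.2).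
Proof.
move=> hg; rewrite comp_mpolyEX /eval_at mevalE raddf_sum mulr_suml !big_seq.
apply: eq_bigr => m /hg <-; rewrite /= mpolyCM -mul_mpolyC -mulrA; congr (_ * _).
rewrite comp_mpolyX rmorph_prod !big_split_ord /= mulrACA !expr_sum -!big_split /=.
apply: eq_bigr => i _.
rewrite !tnth_mktuple (unsplitK (inl i)) (unsplitK (inr i)) !exprMn.
by rewrite /coords !row_mxEl !row_mxEr !rmorphXn.
Qed.

(** By [subst_point], a form is congruent modulo the two linear forms of [P] to its
value at [P] times a product of powers of the forms of [dual_form]. *)
Lemma mem_point_ideal (k : fieldType) (P : P1xP1 k) d g :
  bihomogeneous d g -> eval_at g P = 0 -> point_ideal P g.
Proof.
move=> hg gP.
have [p0 [_ _ p0P]] := dual_form false P; have [p1 [_ _ p1P]] := dual_form true P.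
pose phi b := if b then p1 else p0.
have := @subst_congr _ (point_ideal P) (fun b j => (pt_coord b P j)%:MP * phi b).
move=> /(_ (adjoin_ideal _ _)) Hg; rewrite -[g]subr0.
rewrite -[0](mul0r (phi false ^+ d.1 * phi true ^+ d.2)).
rewrite -mpolyC0 -gP -subst_point //; apply: Hg => -[] j.
  by have [t ->] := p1P j; apply: adjoin_gen.
by have [t ->] := p0P j; apply/adjoin_sub/adjoin_gen.
Qed.

(** * Separators and the deletion of a point *)

(** As [F] vanishes at the points of [X] other than [P], only the value at [P] of
each component of [t] matters. *)
Lemma separator_colon (k : fieldType) (X : {fset P1xP1 k}) P a F t :
  P \in X -> bihomogeneous a F -> separator X P F ->
  ideal_of_points X (t * F) <-> point_ideal P t.
Proof.
move=> PX hF [FP FQ]; have idX := ideal_of_points_ideal X; split.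
  move=> /(ideal_of_points_colon _ _ hF) tF; apply: ideal_parts => [|d].
    exact: adjoin_ideal.
  apply: mem_point_ideal (@part_bihomogeneous k d t) _; apply/eqP.
  by have /eqP := tF d P PX; rewrite mulf_eq0 => /orP[//|/eqP].
have LF b : ideal_of_points X (point_form b P * F).
  apply: ideal_of_points_form (bihomogeneousM (@point_form_bihomogeneous k b P) hF) _.
  move=> Q QX; rewrite eval_atM; have [->|/eqP QP] := eqVneq Q P.
    by rewrite eval_point_form mul0r.
  by rewrite FQ // mulr0.
have idF := colon_ideal F idX.
apply: (ideal_gen_sub idF) => h [|-> //]; apply: (ideal_gen_sub idF) => {}h [->|-> //].
by case: idF.
Qed.

Lemma unique_minimal_degree (S : bidegree -> Prop) a :
  (forall d, minimal_degree S d <-> d = a) -> forall d, S d -> deg_le a d.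
Proof.
move=> Sa d; have [n] := ubnP (d.1 + d.2)%N; elim: n d => // n IHn d dn Sd.
have [/Sa ->|] := classic (minimal_degree S d); first by rewrite /deg_le !leqnn.
move=> nmin; have [e [Se ed ned]] : exists e, [/\ S e, deg_le e d & e <> d].
  apply: NNPP => H; apply: nmin; split=> // e Se ed; apply: NNPP => ned.
  by apply: H; exists e.
have /andP[ed1 ed2] := ed.
have /IHn/(_ Se)/andP[ae1 ae2] : (e.1 + e.2 < n)%N.
  apply: leq_trans (dn : (_ <= n)%N); rewrite ltn_neqAle leq_add // andbT.
  apply/eqP => E; apply: ned; apply: bidegreeP; apply/eqP; rewrite eqn_leq ?ed1 ?ed2 /=.
    by rewrite leqNgt; apply/negP => lt1; have := leq_add lt1 ed2; rewrite addSn E ltnn.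
  by rewrite leqNgt; apply/negP => lt2; have := leq_add ed1 lt2; rewrite addnS E ltnn.
by rewrite /deg_le (leq_trans ae1) // (leq_trans ae2).
Qed.

(** A form of degree [d] that vanishes on [X] without [P], but not at [P], is a
separator, so [d >= a]. The product of [F] with powers of the forms of [dual_form]
then has degree [d] and a nonzero value at [P], and a scalar multiple of it cancels
the value of the form there. *)
Lemma ideal_delete_point (k : fieldType) (X : {fset P1xP1 k}) P a F f :
  P \in X -> (forall d, point_degree X P d <-> d = a) ->
  bihomogeneous a F -> separator X P F ->
  ideal_of_points (X `\ P)%fset f <-> adjoin (ideal_of_points X) F f.
Proof.
move=> PX degP hF [FP FQ].
have idX := ideal_of_points_ideal X; have idY := ideal_of_points_ideal (X `\ P)%fset.
split; last first.
  apply: ideal_gen_sub => // g [|->].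
    apply: ideal_gen_sub => // h [[d hd] hX]; apply: ideal_of_points_form hd _ => Q.
    by rewrite !inE => /andP[_ QX]; apply: hX.
  apply: ideal_of_points_form hF _ => Q; rewrite !inE => /andP[/eqP QP QX].
  exact: FQ.
move=> /ideal_of_pointsP fY; apply: ideal_parts => [|d]; first exact: adjoin_ideal.
have hg := @part_bihomogeneous k d f; have gY := fY d; set g := part d f in hg gY *.
have gY' Q : Q \in X -> Q <> P -> eval_at g Q = 0.
  by move=> QX /eqP QP; apply: gY; rewrite !inE QP.
have [gP|gP] := eqVneq (eval_at g P) 0.
  apply/adjoin_sub/(ideal_of_points_form hg) => Q QX.
  by have [->//|/eqP QP] := eqVneq Q P; apply: gY'.
have /andP[ad1 ad2] : deg_le a d.
  apply: (unique_minimal_degree degP); exists g; split=> //; split=> //.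
  exact/eqP.
have [p0 [hp0 p0P _]] := dual_form false P; have [p1 [hp1 p1P _]] := dual_form true P.
apply/adjoinP => //.
exists ((eval_at g P / eval_at F P)%:MP * (p0 ^+ (d.1 - a.1) * p1 ^+ (d.2 - a.2))).
apply: (@ideal_of_points_form _ _ d).
  apply: bihomogeneousD => //; apply: bihomogeneousN; rewrite -mulrA.
  apply: bihomogeneousCM.
  have dE : d = (bunit false *+ (d.1 - a.1) + bunit true *+ (d.2 - a.2) + a)%R.
    have nat1 n : ((1, 0)%N : bidegree) *+ n = (n, 0)%N.
      by elim: n => // n IHn; rewrite mulrS IHn.
    have nat2 n : ((0, 1)%N : bidegree) *+ n = (0, n)%N.
      by elim: n => // n IHn; rewrite mulrS IHn.
    by rewrite nat1 nat2; apply: bidegreeP; rewrite /= ?addr0 ?add0r; apply/esym/subnK.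
  rewrite [X in bihomogeneous X _]dE.
  by do 2![apply: bihomogeneousM => //]; apply: bihomogeneousX.
have exprP p n : eval_at p P = 1 -> eval_at (p ^+ n) P = 1 :> k.
  by move=> p1'; rewrite /eval_at rmorphXn /= -/(eval_at _ _) p1' expr1n.
move=> Q QX; rewrite eval_atB eval_atM; have [->|/eqP QP] := eqVneq Q P.
  rewrite !eval_atM eval_atC !exprP // !mulr1 divfK ?subrr //; exact/eqP.
by rewrite gY' // (FQ Q) // mulr0 subr0.
Qed.

(** * Length of resolutions in depth two *)

(** A free resolution of length 3 over a ring with a regular sequence [x, y] cannot
have a last map [d2] from a module of rank one with entries in [(x, y)], unless
this is the unit ideal. Writing [d2 = x u + y v], exactness turns the relation
[x u d1 + y v d1 = 0] into [u d1 = - y r] and [v d1 = x r], then [r] into [s d1],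
and finally [u] and [v] into [- y s] and [x s] plus multiples of [d2]. Substituting
gives [d2 = (t x + t' y) d2], whence [1 = t x + t' y]. *)
Lemma depth_two_last_map (A : comNzRingType) (J : A -> Prop) x y p q r
    (d0 : 'M[A]_(p, r)) (d1 : 'M_(q, p)) (d2 : 'M_(1, q)) :
  is_ideal J -> regular_mod J x -> regular_mod (adjoin J x) y ->
  d1 *m d0 = 0 -> d2 *m d1 = 0 -> exact_mod J d1 d0 -> exact_mod J d2 d1 ->
  (forall a, mx_in J (a *: d2) -> J a) ->
  mx_in (adjoin (adjoin J x) y) d2 -> adjoin (adjoin J x) y 1.
Proof.
move=> idJ regx regy d10 d21 ex1 ex2 inj2 d2xy.
have [J0 JD JM] := idJ; have id1 := adjoin_ideal J x.
have [v /(mx_in_adjoin idJ) [u Juv]] := mx_in_adjoin id1 d2xy.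
have {}Juv : mx_in J (d2 - (x *: u + y *: v)) 
  by rewrite opprD addrA addrAC.
have Juv1 : mx_in J (x *: (u *m d1) + y *: (v *m d1)).
  have := mx_in_mulr d1 idJ Juv; rewrite mulmxBl d21 sub0r => /(mx_inZ (-1) idJ).
  by rewrite scalerN scaleN1r opprK mulmxDl -!scalemxAl.
have [r1 Jv] : exists w, mx_in J (v *m d1 - x *: w).
  apply: (mx_in_adjoin idJ) => i j; apply: regy.
  apply/adjoinP => //; exists (- (u *m d1) i j).
  by have := Juv1 i j; rewrite !mxE mulNr opprK addrC [X in _ + X]mulrC.
have Ju : mx_in J (u *m d1 + y *: r1).
  move=> i j; apply: regx.
  have := mx_inB idJ Juv1 (mx_inZ y idJ Jv); move/(_ i j); rewrite !mxE.
  by congr J; ring.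
have [s Js] : exists s, mx_in J (r1 - s *m d1).
  apply: ex1 => i j; apply: regx.
  have := mx_inZ (-1) idJ (mx_in_mulr d0 idJ Jv).
  rewrite mulmxBl -mulmxA d10 mulmx0 sub0r scaleN1r opprK -scalemxAl.
  by move/(_ i j); rewrite mxE.
have [t Jt] : exists t, mx_in J (u + y *: s - t *m d2).
  apply: ex2; rewrite mulmxDl -scalemxAl.
  rewrite (_ : _ + _ = (u *m d1 + y *: r1) - y *: (r1 - s *m d1)); last first.
    by rewrite scalerBr opprB addrA (addrAC _ (y *: r1)) addrK.
  by apply: mx_inB => //; apply: mx_inZ.
have [t' Jt'] : exists t, mx_in J (v - x *: s - t *m d2).
  apply: ex2; rewrite mulmxBl -scalemxAl.
  rewrite (_ : _ - _ = (v *m d1 - x *: r1) + x *: (r1 - s *m d1)); last first.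
    by rewrite scalerBr addrA addrNK.
  by apply: mx_inD => //; apply: mx_inZ.
have J1 : J (1 - t' 0 0 * y - t 0 0 * x).
  apply: inj2; rewrite !scalerBl scale1r -!scalerA.
  rewrite (_ : _ - _ = (d2 - (x *: u + y *: v)) + x *: (u + y *: s - t *m d2)
    + y *: (v - x *: s - t' *m d2)); last first.
    apply/matrixP => i j; rewrite !mxE !big_ord1 !ord1; ring.
  by apply: mx_inD => //; first apply: mx_inD => //; apply: mx_inZ.
by apply/adjoinP => //; exists (t' 0 0); apply/adjoinP => //; exists (t 0 0).
Qed.

Lemma gen_ideal_irrelevant (k : fieldType) (c e : k) (f : bipoly k) :
  irrelevant_ideal f ->
  adjoin (adjoin (gen_ideal c e) (bvar false 1)) (bvar true 1) f.
Proof.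
set J := adjoin _ _; have idJ : is_ideal J := adjoin_ideal _ _.
move=> irrf; rewrite -[f]mulr1; move: f irrf.
apply: (irrelevant_colon (c := c) (e := e)) => //; rewrite mulr1.
- by do 3!apply: adjoin_sub; apply: ideal_gen_mem; right.
- by do 2!apply: adjoin_sub; apply: ideal_gen_mem; right.
- by apply: adjoin_sub; apply: ideal_gen_mem; right.
- by apply: ideal_gen_mem; right.
Qed.

Lemma gen_ideal_sub_irrelevant (k : fieldType) (c e : k) (f : bipoly k) :
  gen_ideal c e f -> irrelevant_ideal f.
Proof.
have irr := @irrelevant_ideal_ideal k; have [irr0 _ _] := irr.
have irrgen b a := linear_irrelevant (@gen_form_bihomogeneous k b a).
apply: ideal_gen_sub => // g [|-> //]; apply: ideal_gen_sub => // {}g [-> //|-> //].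
Qed.

Lemma points_resolution_exact (k : fieldType) (c e : k) (Y : {fset P1xP1 k}) Fs delta :
  avoids false c Y -> avoids true e Y -> depth_quotient (ideal_of_points Y) 2 ->
  @minimal_resolution k (ideal_of_points Y) Fs delta ->
  forall i, exact_mod (gen_ideal c e) (delta i.+1) (delta i).
Proof.
move=> avc ave depth2 res; apply: resolution_exact_mod res _ _ _ _ _.
- exact: ideal_of_points_ideal.
- exact: regular_mod_zero (gen_form_neq0 _ _).
- exact: gen_form_regular_true.
- exact: gen_form_regular.
- exact: depth_two_regular.
Qed.

(** The instance of the Auslander-Buchsbaum bound used here: a quotient of depth 2
has no minimal resolution of length 3. *)
Lemma depth_two_resolution_length (k : closedFieldType) (Y : {fset P1xP1 k}) G1 G2 d :
  depth_quotient (ideal_of_points Y) 2 ->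
  ~ has_minimal_resolution (ideal_of_points Y) [:: G1; G2; [:: d]].
Proof.
move=> depth2 [delta res].
have [c avc] := exists_avoids false Y; have [e ave] := exists_avoids true Y.
have ex := points_resolution_exact avc ave depth2 res.
have dd := resolution_complex res.
have idJ : is_ideal (gen_ideal c e) := adjoin_ideal _ _.
apply: (@one_not_irrelevant k).
have irr := @irrelevant_ideal_ideal k.
have : adjoin (adjoin (gen_ideal c e) (bvar false 1)) (bvar true 1) 1.
  apply: (@depth_two_last_map _ (gen_ideal c e) (bvar false 1) (bvar true 1)
    _ _ _ (delta 0%N) (delta 1%N) (delta 2%N)) => //.
  - exact: last_var_regular_false.
  - exact: last_var_regular_true.
  - exact: (dd 1%N).
  - exact: (ex 1%N).
  (* The next module of the resolution is zero, so the last map stays injective. *)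
  - move=> a Ja; have [|w Jw] := ex 2%N (a%:M); first by rewrite mul_scalar_mx.
    have := Jw 0 0; rewrite (_ : w *m _ = 0) ?subr0 ?mxE ?mulr1n //.
    by apply/matrixP => i j; rewrite !mxE big_ord0.
  - by move=> i j; apply/gen_ideal_irrelevant/(res_minimal res).
apply: ideal_gen_sub => // f [|->]; last exact: bvar_irrelevant.
move: f; apply: ideal_gen_sub => // f [|->]; last exact: bvar_irrelevant.
exact: gen_ideal_sub_irrelevant.
Qed.

(** * Minimality of the comparison map *)

(** If [F = w d0] modulo [J], then [w1 - x w] and [w2 - y w] are relations modulo
[J], hence of the form [u1 d1] and [u2 d1]; as [d1] is injective modulo [J], the row
[u] is determined by them. *)
Lemma cone_map_mod (A : comNzRingType) (J : A -> Prop) F x y p q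
    (d0 : 'M[A]_(p, 1)) (d1 : 'M_(q, p)) (w w1 w2 : 'rV_p) (u : 'rV_q) :
  is_ideal J -> mx_in J (F%:M - w *m d0) ->
  w1 *m d0 = (x * F)%:M -> w2 *m d0 = (y * F)%:M -> u *m d1 = y *: w1 - x *: w2 ->
  exact_mod J d1 d0 -> (forall v : 'rV_q, mx_in J (v *m d1) -> mx_in J v) ->
  exists u1 u2 : 'rV_q, mx_in J (u - (y *: u1 - x *: u2)).
Proof.
move=> idJ Jw w1F w2F ud ex inj.
have lift z v : v *m d0 = (z * F)%:M -> exists s, mx_in J (v - z *: w - s *m d1).
  move=> vF; apply: ex; rewrite mulmxBl vF -scalemxAl -scale_scalar_mx -scalerBr.
  exact: mx_inZ.
have [u1 Ju1] := lift _ _ w1F; have [u2 Ju2] := lift _ _ w2F.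
exists u1, u2; apply: inj; rewrite !mulmxBl -!scalemxAl ud.
rewrite (_ : _ - _ = y *: (w1 - x *: w - u1 *m d1) - x *: (w2 - y *: w - u2 *m d1)).
  by apply: mx_inB => //; apply: mx_inZ.
rewrite !scalerBr !scalerA [x * y]mulrC !opprB; apply/matrixP => i j.
by rewrite !mxE; ring.
Qed.

(** A form that does not vanish at [P] and the form that vanishes there are linearly
independent, so the two generate the variables of their factor. *)
Lemma irrelevant_sub_avoiding (k : fieldType) (K : bipoly k -> Prop) (P : P1xP1 k)
    (c e : k) :
  is_ideal K -> eval_at (gen_form false c) P != 0 -> eval_at (gen_form true e) P != 0 ->
  K (gen_form false c) -> K (gen_form true e) ->
  K (point_form false P) -> K (point_form true P) ->
  forall f, irrelevant_ideal f -> K f.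
Proof.
move=> idK cP eP Kc Ke K0 K1; have [_ KD KM] := idK.
have Kv b a : eval_at (gen_form b a) P != 0 -> K (gen_form b a) ->
    K (point_form b P) -> K (bvar b 1).
  rewrite eval_gen_form; set u := _ + _ => u0 Ka Kb.
  have -> : bvar b 1 =
      u^-1%:MP * (point_form b P + (pt_coord b P 1)%:MP * gen_form b a).
    rewrite -[LHS]mul1r -mpolyC1 -(mulVf u0) mpolyCM -mulrA; congr (_ * _).
    by rewrite /u mpolyCD mpolyCM /point_form /gen_form; ring.
  by apply: (KM); apply: KD => //; apply: KM.
have Kc' := Kv _ _ cP Kc K0; have Ke' := Kv _ _ eP Ke K1.
move=> f irrf; rewrite -[f]mulr1; move: f irrf.
by apply: (irrelevant_colon (c := c) (e := e)) => //; rewrite mulr1.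
Qed.

(** A relation [m n = g + t F + h l] with [g] in [I_X] involves [t] only modulo
[(I_X : F, l, m)], which contains the irrelevant ideal. So [t] may be taken
constant. If it is zero, [n] minus a multiple of [F] is killed by [m] modulo
[(I_X, l)], where [m] is regular; otherwise [F] would lie in [(I_X, l, m)]. *)
Lemma regular_after_separator (k : fieldType) (X : {fset P1xP1 k}) P a F (c e : k) :
  P \in X -> bihomogeneous a F -> separator X P F ->
  avoids false c X -> avoids true e X ->
  (forall f, ideal_of_points (X `\ P)%fset f <-> adjoin (ideal_of_points X) F f) ->
  regular_mod (adjoin (ideal_of_points X) (gen_form false c)) (gen_form true e) ->
  ~ adjoin (adjoin (ideal_of_points X) (gen_form false c)) (gen_form true e) F ->
  regular_mod (adjoin (ideal_of_points (X `\ P)%fset) (gen_form false c))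
    (gen_form true e).
Proof.
set L := gen_form false c; set M := gen_form true e.
move=> PX hF sepF avc ave IY regM nF n.
have idX := ideal_of_points_ideal X; have idY := ideal_of_points_ideal (X `\ P)%fset.
move=> /adjoinP-/(_ idY) [h /IY /adjoinP-/(_ idX) [t It]].
pose K0 := fun g => ideal_of_points X (g * F).
have idK0 : is_ideal K0 := colon_ideal F idX.
have id1 := adjoin_ideal K0 L.
have point_mem : forall g, point_ideal P g -> K0 g.
  by move=> g; apply: (separator_colon g PX hF sepF).2.
have : adjoin (adjoin K0 L) M (t - (t@_0%MM)%:MP).
  apply: (@irrelevant_sub_avoiding _ _ P c e); rewrite ?avc ?ave //.
  - exact: adjoin_ideal.
  - by apply: adjoin_sub; apply: ideal_gen_mem; right.
  - by apply: ideal_gen_mem; right.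
  - do 2!apply: adjoin_sub; apply: point_mem.
    by apply: adjoin_sub; apply: ideal_gen_mem; right.
  - do 2!apply: adjoin_sub; apply: point_mem.
    by apply: ideal_gen_mem; right.
  - by apply/irrelevantP; rewrite mcoeffB mcoeffC eqxx mulr1 subrr.
move=> /adjoinP-/(_ id1) [s /adjoinP-/(_ idK0) [r Kt]].
have [c0|c0] := eqVneq t@_0%MM 0.
  have : adjoin (ideal_of_points X) L (n - s * F).
    apply: regM; apply/adjoinP => //; exists (h + r * F).
    rewrite c0 mpolyC0 subr0 in Kt; case: (idX) => _ XD _.
    have := XD _ _ It Kt; congr (ideal_of_points X _); ring.
  move=> /adjoinP-/(_ idX) [g Ig]; apply/adjoinP => //; exists g.
  apply/IY; apply/adjoinP => //; exists s.
  by move: Ig; congr (ideal_of_points X _); ring.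
case: nF; apply/adjoinP; first exact: adjoin_ideal.
set c1 := t@_0%MM in c0 Kt.
have c1V : c1^-1%:MP * c1%:MP = 1 :> bipoly k by rewrite -mpolyCM mulVf // mpolyC1.
exists (c1^-1%:MP * (n - s * F)); apply/adjoinP => //.
exists (- (c1^-1%:MP * (h + r * F))).
case: (idX) => _ XD XM.
have := XM (- c1^-1%:MP) _ (XD _ _ It Kt); congr (ideal_of_points X _).
transitivity ((c1^-1%:MP * c1%:MP) * F - c1^-1%:MP * (n - s * F) * M
  - - (c1^-1%:MP * (h + r * F)) * L); last by rewrite c1V mul1r.
ring.
Qed.

Lemma mderiv_irrelevant_mul (k : fieldType) i (f g : bipoly k) :
  irrelevant_ideal f -> irrelevant_ideal g -> irrelevant_ideal (f * g)^`M(i).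
Proof.
move=> irrf irrg; have [_ irrD irrM] := @irrelevant_ideal_ideal k.
rewrite mderivM; apply: irrD; first exact: irrM.
exact: (is_idealMr _ (@irrelevant_ideal_ideal k)).
Qed.

Lemma mderiv_point_form (k : fieldType) b (P : P1xP1 k) b' j :
  (point_form b P)^`M(var_index b' j) =
  ((b == b')%:R * (if j == 0 then - pt_coord b P 1 else pt_coord b P 0))%:MP.
Proof.
rewrite /point_form mderivB !mderiv_mulC !mderiv_bvar -!mpolyCM -mpolyCB; congr (_%:MP).
by have [->|->] := ord2P j; rewrite !(eqxx, andbT, andbF) /= ?mulr0 ?subr0 ?sub0r ?mulr1;
  case: (b == b'); rewrite ?mulr1 ?mulr0 ?mul1r ?mul0r ?oppr0.
Qed.

(** The left side of the relation is in the square of the irrelevant ideal, so its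
partial derivatives have no constant term. The forms of the two factors involve
disjoint variables: the derivatives in the variables of one factor isolate
the constant term of one of [w1] and [w2]. *)
Lemma cone_minimal (k : fieldType) (P : P1xP1 k) p q
    (d1 : 'M[bipoly k]_(q, p)) (u : 'rV_q) (w1 w2 : 'rV_p) :
  mx_in (@irrelevant_ideal k) d1 -> mx_in (@irrelevant_ideal k) u ->
  u *m d1 = point_form true P *: w1 - point_form false P *: w2 ->
  mx_in (@irrelevant_ideal k) w1 /\ mx_in (@irrelevant_ideal k) w2.
Proof.
move=> irrd irru ud.
have irr := @irrelevant_ideal_ideal k; have [_ irrD irrM] := irr.
have irrP b : irrelevant_ideal (point_form b P).
  exact: linear_irrelevant (@point_form_bihomogeneous k b P).
have der j i : irrelevant_ideal
    ((point_form true P)^`M(i) * w1 0 j - (point_form false P)^`M(i) * w2 0 j).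
  have irrud : irrelevant_ideal ((u *m d1) 0 j)^`M(i).
    rewrite mxE raddf_sum /=; apply: is_ideal_sum => // l _.
    exact: mderiv_irrelevant_mul.
  rewrite ud !mxE mderivB !mderivM in irrud.
  have := is_idealB irr irrud (is_idealB irr (irrM (w1 0 j)^`M(i) _ (irrP true))
    (irrM (w2 0 j)^`M(i) _ (irrP false))).
  by congr irrelevant_ideal; ring.
have cancel b (w : bipoly k) : (forall i, irrelevant_ideal
    ((point_form b P)^`M(var_index b i) * w)) -> irrelevant_ideal w.
  move=> irrw; suff [a a0 irra] : exists2 a : k, a != 0 & irrelevant_ideal (a%:MP * w).
    by rewrite -[w]mul1r -mpolyC1 -(mulVf a0) mpolyCM -mulrA; apply: irrM.
  have [P0|P1] := pt_coord_neq0 b P.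
    exists (pt_coord b P 0) => //.
    by have := irrw 1; rewrite mderiv_point_form eqxx mul1r.
  exists (- pt_coord b P 1); first by rewrite oppr_eq0.
  by have := irrw 0; rewrite mderiv_point_form eqxx mul1r.
split=> i j; rewrite ord1.
  apply: (cancel true) => l; have := der j (var_index true l).
  by rewrite [X in _ - X * _]mderiv_point_form mul0r mpolyC0 mul0r subr0.
apply: (cancel false) => l; have := is_idealN irr (der j (var_index false l)).
by rewrite [X in - (X * _ - _)]mderiv_point_form mul0r mpolyC0 mul0r sub0r opprK.
Qed.

(** * The mapping cone *)

(** A lift through a graded map can be made graded by keeping the components of the
right degrees. A row of degree [d] is treated as a graded map from a module
with a single shift. *)
Lemma graded_lift (k : fieldType) (C D E : free_module)
    (M : 'M[bipoly k]_(size D, size E)) (V : 'M_(size C, size E)) :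
  graded_map M -> graded_map V ->
  (forall r, exists w, w *m M = row r V) ->
  exists2 W : 'M_(size C, size D), graded_map W & W *m M = V.
Proof.
move=> grM grV /fin_all_exists [w wM].
exists (\matrix_(r, i) mfilter
  (fun m => mbideg m + nth (0, 0)%N D i == nth (0, 0)%N C r) (w r 0 i)).
  by move=> r i m; rewrite mxE => /msupp_mfilter [/eqP].
apply/matrixP => r j; rewrite mxE.
have Vrj : V r j = (w r *m M) 0 j by rewrite wM mxE.
rewrite -(@mfilter_id _ _ (fun m => mbideg m + nth (0, 0)%N E j == nth (0, 0)%N C r)
  (V r j)); last by move=> m /grV ->.
rewrite Vrj mxE mfilter_sum; apply: eq_bigr => i _; rewrite mxE.
apply/esym/mfilterM => m1 m2 /grM Mij.
by rewrite mbidegD -addrA Mij.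
Qed.

(** The sizes are variables so that block matrices can be used although the size of
a concatenation is only propositionally equal to a sum. *)
Lemma minimal_resolution3 (k : fieldType) (I : bipoly k -> Prop)
    (E1 E2 E3 : free_module) p q r (sE1 : p = size E1) (sE2 : q = size E2)
    (sE3 : r = size E3)
    (d0 : 'M[bipoly k]_(p, 1)) (d1 : 'M_(q, p)) (d2 : 'M_(r, q)) :
  (forall i j m, m \in msupp (d0 i j) -> mbideg m = nth (0, 0)%N E1 i) ->
  (forall i j m, m \in msupp (d1 i j) ->
    mbideg m + nth (0, 0)%N E1 j = nth (0, 0)%N E2 i) ->
  (forall i j m, m \in msupp (d2 i j) ->
    mbideg m + nth (0, 0)%N E2 j = nth (0, 0)%N E3 i) ->
  (forall f, I f <-> exists w, w *m d0 = f%:M) ->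
  d1 *m d0 = 0 -> d2 *m d1 = 0 ->
  (forall v : 'rV_p, v *m d0 = 0 -> exists w, w *m d1 = v) ->
  (forall v : 'rV_q, v *m d1 = 0 -> exists w, w *m d2 = v) ->
  (forall v : 'rV_r, v *m d2 = 0 -> v = 0) ->
  mx_in (@irrelevant_ideal k) d0 -> mx_in (@irrelevant_ideal k) d1 ->
  mx_in (@irrelevant_ideal k) d2 ->
  has_minimal_resolution I [:: E1; E2; E3].
Proof.
subst p q r => gr0 gr1 gr2 aug d10 d21 ex0 ex1 inj2 irr0 irr1 irr2.
pose Fs := [:: E1; E2; E3].
have size0 i : size (res_module Fs i.+4) = 0%N by rewrite /res_module nth_default.
pose delta i : 'M[bipoly k]_(size (res_module Fs i.+1), size (res_module Fs i)) :=
  match i return 'M[bipoly k]_(size (res_module Fs i.+1), size (res_module Fs i)) with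
  | 0%N => d0 | 1%N => d1 | 2%N => d2 | _ => 0
  end.
exists delta; split => //.
- move=> [|[|[|i]]] //; last by move=> j l m; rewrite mxE msupp0.
  move=> i j m /gr0 <-; rewrite (_ : nth _ _ _ = 0) ?addr0 //.
  by rewrite ord1.
- move=> [|[|[|i]]] v; split=> [|[w <-]] /=.
  + exact: ex0.
  + by rewrite -mulmxA d10 mulmx0.
  + exact: ex1.
  + by rewrite -mulmxA d21 mulmx0.
  + by move/inj2 ->; exists 0; rewrite mul0mx.
  + by rewrite mulmx0 mul0mx.
  + move=> _; exists 0; rewrite mul0mx; apply/rowP => j.
    by have := ltn_ord j; rewrite [X in (_ < X)%N]size0.
  + by rewrite mulmx0.
- move=> [|[|[|i]]] // j l; rewrite mxE.
  by case: (@irrelevant_ideal_ideal k).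
Qed.

(** The mapping cone of the lift of [F] from the Koszul complex of the two linear
forms of [P]. The rows [w1], [w2] and [u] of the lift are only known to exist, so
the condition that makes the cone minimal is required of all of them. *)
Lemma cone_resolution (k : fieldType) (X : {fset P1xP1 k}) (F1 F2 : free_module)
    P a F Q delta :
  @minimal_resolution k (ideal_of_points X) [:: F1; F2] delta ->
  P \in X -> bihomogeneous a F -> separator X P F ->
  (forall f, ideal_of_points (X `\ P)%fset f <-> adjoin (ideal_of_points X) F f) ->
  Q \in (X `\ P)%fset ->
  (forall (w1 w2 : 'rV_(size F1)) (u : 'rV_(size F2)),
    w1 *m delta 0%N = (point_form false P * F)%:M ->
    w2 *m delta 0%N = (point_form true P * F)%:M ->
    u *m delta 1%N = point_form true P *: w1 - point_form false P *: w2 ->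
    mx_in (@irrelevant_ideal k) u) ->
  has_minimal_resolution (ideal_of_points (X `\ P)%fset)
    [:: F1 ++ [:: a]; F2 ++ [:: bunit false + a; bunit true + a];
        [:: bunit false + bunit true + a]].
Proof.
set L := point_form false P; set M := point_form true P.
move=> res PX hF sepF IY QY irru.
have idX := ideal_of_points_ideal X.
have irr := @irrelevant_ideal_ideal k; have [irr0 _ _] := irr.
have dd := resolution_complex res.
have hL : bihomogeneous (bunit false) L by exact: point_form_bihomogeneous.
have hM : bihomogeneous (bunit true) M by exact: point_form_bihomogeneous.
have colonF := separator_colon _ PX hF sepF.
have inj (v : 'rV_(size F2)) : v *m delta 1%N = 0 -> v = 0.
  move=> /(@res_exact _ _ _ _ res 1%N _) [w <-]; apply/matrixP => i j.
  by rewrite !mxE big_ord0.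
have IXL : ideal_of_points X (L * F).
  by apply/colonF; apply: adjoin_sub; apply: ideal_gen_mem; right.
have IXM : ideal_of_points X (M * F) by apply/colonF; apply: ideal_gen_mem; right.
have lift1 b : ideal_of_points X (point_form b P * F) ->
    exists2 w : 'rV_(size F1), (forall j m, m \in msupp (w 0 j) ->
      mbideg m + nth (0, 0)%N F1 j = bunit b + a) &
      w *m delta 0%N = (point_form b P * F)%:M.
  move=> /(res_augmentation res) [w0 w0E].
  have [||w grw wE] := @graded_lift k [:: bunit b + a] F1 [:: (0, 0)%N]
    (delta 0%N) ((point_form b P * F)%:M) (@res_graded _ _ _ _ res 0%N).
  - move=> i j m; rewrite !ord1 mxE eqxx mulr1n /= addr0.
    exact: (bihomogeneousM (@point_form_bihomogeneous k b P) hF).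
  - by move=> r; exists w0; rewrite w0E; apply/matrixP => i j; rewrite !ord1 !mxE.
  by exists w => // j m /grw.
have [w1 grw1 w1E] := lift1 _ IXL; have [w2 grw2 w2E] := lift1 _ IXM.
rewrite -/L in w1E; rewrite -/M in w2E.
have cone0 : (M *: w1 - L *: w2) *m delta 0%N = 0.
  rewrite mulmxBl -!scalemxAl w1E w2E !scale_scalar_mx.
  by rewrite (_ : M * (L * F) = L * (M * F)) ?subrr //; ring.
have [u gru uE] : exists2 u : 'rV_(size F2), (forall j m, m \in msupp (u 0 j) ->
      mbideg m + nth (0, 0)%N F2 j = bunit false + bunit true + a) &
      u *m delta 1%N = M *: w1 - L *: w2.
  have [u0 u0E] := (@res_exact _ _ _ _ res 0%N _).1 cone0.
  have [||u gru uE] := @graded_lift k [:: bunit false + bunit true + a] F2 F1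
    (delta 1%N) (M *: w1 - L *: w2) (@res_graded _ _ _ _ res 1%N).
  - move=> i j m; rewrite ord1 !mxE => /msuppB_le; rewrite mem_cat.
    case/orP => /msuppM_le /allpairsP [[m1 m2] [/= m1M m2w ->]]; rewrite mbidegD -addrA.
      by rewrite (hM _ m1M) (grw1 _ _ m2w) addrCA addrA.
    by rewrite (hL _ m1M) (grw2 _ _ m2w) addrA.
  - move=> r; exists u0; rewrite u0E; apply/matrixP => i j.
    by rewrite [in RHS]mxE !ord1.
  by exists u => // j m /gru.
have irr_u := irru _ _ _ w1E w2E uE.
have [irrw1 irrw2] : mx_in (@irrelevant_ideal k) w1 /\ mx_in (@irrelevant_ideal k) w2.
  by apply: cone_minimal irr_u uE; apply: (@res_minimal _ _ _ _ res 1%N).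
have irrL := linear_irrelevant hL; have irrM := linear_irrelevant hM.
have irrF : irrelevant_ideal F.
  apply: (ideal_of_points_irrelevant QY); apply/IY.
  by apply: ideal_gen_mem; right.
have nthcat (s t : free_module) i :
    nth (0, 0)%N (s ++ t) (size s + i) = nth (0, 0)%N t i.
  by rewrite nth_cat ltnNge leq_addr addKn.
have nthcatl (s t : free_module) (i : 'I_(size s)) :
    nth (0, 0)%N (s ++ t) i = nth (0, 0)%N s i.
  by rewrite nth_cat ltn_ord.
pose d0 : 'M[bipoly k]_(size F1 + 1, 1) := col_mx (delta 0%N) F%:M.
pose d1 : 'M[bipoly k]_(size F2 + (1 + 1), size F1 + 1) :=
  block_mx (delta 1%N) 0 (- col_mx w1 w2) (col_mx L%:M M%:M).
pose d2 : 'M[bipoly k]_(1, size F2 + (1 + 1)) := row_mx u (row_mx M%:M (- L%:M)).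
apply: (@minimal_resolution3 _ _ _ _ _ (size F1 + 1)%N (size F2 + (1 + 1))%N 1%N
  _ _ _ d0 d1 d2); rewrite ?size_cat //.
- move=> i j m; rewrite /d0 mxE; case: split_ordP => l -> /=.
    rewrite nthcatl => /(@res_graded _ _ _ _ res 0%N) <-.
    by rewrite (_ : nth _ _ _ = 0) ?addr0 // ord1.
  by rewrite !ord1 nthcat mxE mulr1n => /hF.
- move=> i j m; rewrite /d1 mxE; case: split_ordP => l ->; rewrite mxE;
    case: split_ordP => n ->; rewrite /= ?nthcatl ?nthcat.
  + exact: (@res_graded _ _ _ _ res 1%N).
  + by rewrite mxE msupp0.
  + rewrite !mxE (perm_mem (msuppN _)).
    by case: split_ordP => e ->; rewrite !ord1 /=; [apply: grw1|apply: grw2].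
  + rewrite mxE; case: split_ordP => e ->; rewrite !ord1 mxE mulr1n /=.
      by move=> /hL ->.
    by move=> /hM ->.
- move=> i j m; rewrite /d2 mxE ord1.
  case: split_ordP => l ->; rewrite /= ?nthcatl ?nthcat.
    exact: gru.
  rewrite mxE; case: split_ordP => e ->; rewrite !ord1 !mxE mulr1n /=.
    by move=> /hM ->; rewrite addrA [_ + bunit false]addrC.
  by rewrite (perm_mem (msuppN _)) => /hL ->; rewrite addrA.
- move=> f; split.
    move=> /IY /adjoinP-/(_ idX) [t /(res_augmentation res) [w wE]].
    exists (row_mx w t%:M); rewrite mul_row_col wE -scalar_mxM -raddfD /=.
    by rewrite subrK.
  case=> w wE; apply/IY; apply/adjoinP => //.
  exists (rsubmx w 0 0); apply/(res_augmentation res); exists (lsubmx w).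
  rewrite raddfB /=; apply: (canRL (addrK _)).
  by rewrite scalar_mxM -mx11_scalar -mul_row_col hsubmxK.
- rewrite /d1 /d0 mul_block_col (dd 0%N) mul0mx addr0 mulNmx !mul_col_mx w1E w2E.
  by rewrite -!scalar_mxM addNr col_mx0.
- rewrite /d2 /d1 mul_row_block uE mulmx0 add0r mulmxN !mul_row_col.
  rewrite !mulNmx !mul_scalar_mx !scale_scalar_mx subrr [L * M]mulrC subrr.
  by rewrite row_mx0.
(* The coefficient t of F is in I_X : F = (L, M), which reduces the relation to one
   among the generators of I_X. *)
- move=> v; rewrite -[v]hsubmxK /d0 mul_row_col => vd.
  set v1 := lsubmx v in vd *; set t := rsubmx v in vd *.
  have : ideal_of_points X (t 0 0 * F).
    apply/(res_augmentation res); exists (- v1); rewrite mulNmx.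
    by apply/eqP; rewrite eq_sym -addr_eq0 addrC scalar_mxM -mx11_scalar vd.
  have id0 := @zero_ideal_ideal (bipoly k).
  move=> /colonF /adjoinP-/(_ (adjoin_ideal _ _)) [s2 /adjoinP-/(_ id0) [s1 ts]].
  have {}ts : t 0 0 = s2 * M + s1 * L.
    by apply/eqP; rewrite -subr_eq0 opprD addrA; apply/eqP.
  have [|u' u'E] := (@res_exact _ _ _ _ res 0%N (v1 + s1 *: w1 + s2 *: w2)).1.
    rewrite !mulmxDl -!scalemxAl w1E w2E !scale_scalar_mx -addrA -raddfD /=.
    by rewrite -[RHS]vd [t]mx11_scalar ts -scalar_mxM; congr (_ + _%:M); ring.
  exists (row_mx u' (row_mx s1%:M s2%:M)).
  rewrite /d1 mul_row_block mulmx0 add0r mulmxN !mul_row_col !mul_scalar_mx.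
  rewrite u'E -[v1 + _ + _]addrA addrK !scale_scalar_mx -raddfD /=.
  by rewrite [t]mx11_scalar ts addrC.
(* The coefficients (a, b) of the two Koszul generators satisfy a L + b M = 0, so they
   are a multiple of (M, - L); the rest follows from injectivity of delta 1. *)
- move=> v; rewrite -[v]hsubmxK -[rsubmx v]hsubmxK /d1 mul_row_block.
  set v1 := lsubmx v; set a1 := lsubmx (rsubmx v); set b1 := rsubmx (rsubmx v).
  rewrite mulmx0 add0r mulmxN !mul_row_col -row_mx0 => /eq_row_mx [vd abLM].
  rewrite [a1]mx11_scalar [b1]mx11_scalar in vd abLM *.
  set x := a1 0 0 in vd abLM *; set y := b1 0 0 in vd abLM *.
  have {}abLM : x * L + y * M = 0.
    have := congr1 (fun N : 'M_1 => N 0 0) abLM.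
    by rewrite -!scalar_mxM !mxE eqxx !mulr1n.
  have id0 := @zero_ideal_ideal (bipoly k).
  have /adjoinP-/(_ id0) [r yr] : adjoin (@zero_ideal _) L y.
    apply: point_forms_regular; apply/adjoinP => //; exists (- x).
    by rewrite mulNr opprK addrC [M * y]mulrC.
  have {}yr : y = r * L by apply/eqP; rewrite -subr_eq0; apply/eqP.
  have xr : x = - r * M.
    apply/eqP; rewrite -subr_eq0; apply/eqP.
    apply: (regular_mod_zero (point_form_neq0 false P)); rewrite -/L.
    by rewrite /zero_ideal -abLM yr; ring.
  have -> : v1 = - r *: u.
    apply/eqP; rewrite -subr_eq0; apply/eqP/inj.
    rewrite mulmxBl -scalemxAl uE scalerBr !scalerA -xr mulNr -yr scaleNr opprK.
    by rewrite -[RHS]vd !mul_scalar_mx opprD.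
  exists (- r)%:M; rewrite /d2 mul_scalar_mx !scale_row_mx scalerN !scale_scalar_mx.
  by rewrite -raddfN /= xr yr [- r * L]mulNr opprK.
- move=> v; rewrite /d2 mul_mx_row -row_mx0 => /eq_row_mx [_].
  rewrite mul_mx_row -row_mx0 => /eq_row_mx [vM _].
  rewrite [v]mx11_scalar; move: vM; rewrite {1}[v]mx11_scalar -scalar_mxM.
  move=> /(congr1 (fun N : 'M_1 => N 0 0)); rewrite !mxE eqxx mulr1n => /eqP.
  rewrite mulf_eq0 (negPf (point_form_neq0 true P)) orbF => /eqP ->.
  by rewrite raddf0.
- move=> i j; rewrite /d0 mxE; case: split => l.
    exact: (@res_minimal _ _ _ _ res 0%N).
  by rewrite !ord1 mxE mulr1n.
- move=> i j; rewrite /d1 mxE; case: split => l; rewrite mxE; case: split => n.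
  + exact: (@res_minimal _ _ _ _ res 1%N).
  + by rewrite mxE.
  + by rewrite !mxE; apply: is_idealN => //; case: split => ?.
  + by rewrite mxE; case: split => ?; rewrite !ord1 mxE mulr1n.
- move=> i j; rewrite /d2 mxE; case: split => l; rewrite ?ord1 //.
  rewrite mxE; case: split => ?; rewrite !ord1 !mxE mulr1n //.
  exact: is_idealN.
Qed.

(** * Deletion of a point from an ACM set *)

Lemma resolution_proper (k : fieldType) (I : bipoly k -> Prop) Fs :
  has_minimal_resolution I Fs -> ~ I 1.
Proof.
move=> [delta res] /(res_augmentation res) [w w1]; apply: (@one_not_irrelevant k).
have -> : (1 : bipoly k) = (w *m delta 0%N) 0 0 by rewrite w1 mxE eqxx.
apply: mx_in_mull; first exact: irrelevant_ideal_ideal.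
exact: (@res_minimal _ _ _ _ res 0%N).
Qed.

(** As [R/I_Y] does not have depth 2, [regular_after_separator] leaves only the case
that [F] lies in [I_X] modulo two general linear forms, and then [cone_map_mod]
applies. *)
Lemma cone_last_map_irrelevant (k : closedFieldType) (X : {fset P1xP1 k}) P a F
    (F1 F2 : free_module) delta Q :
  @minimal_resolution k (ideal_of_points X) [:: F1; F2] delta ->
  depth_quotient (ideal_of_points X) 2 ->
  P \in X -> bihomogeneous a F -> separator X P F ->
  (forall f, ideal_of_points (X `\ P)%fset f <-> adjoin (ideal_of_points X) F f) ->
  Q \in (X `\ P)%fset -> ~ depth_quotient (ideal_of_points (X `\ P)%fset) 2 ->
  forall (w1 w2 : 'rV_(size F1)) (u : 'rV_(size F2)),
    w1 *m delta 0%N = (point_form false P * F)%:M ->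
    w2 *m delta 0%N = (point_form true P * F)%:M ->
    u *m delta 1%N = point_form true P *: w1 - point_form false P *: w2 ->
    mx_in (@irrelevant_ideal k) u.
Proof.
move=> res depthX PX hF sepF IY QY ndepthY w1 w2 u w1E w2E uE.
have idX := ideal_of_points_ideal X; have irr := @irrelevant_ideal_ideal k.
have [c avc] := exists_avoids false X; have [e ave] := exists_avoids true X.
have subY b x : avoids b x X -> avoids b x (X `\ P)%fset.
  by move=> av R; rewrite !inE => /andP[_]; apply: av.
have [FJ|nF] := classic (adjoin (adjoin (ideal_of_points X) (gen_form false c))
    (gen_form true e) F); last first.
  case: ndepthY; apply: (regular_depth_two QY (subY _ _ avc) (subY _ _ ave)).
  apply: (regular_after_separator PX hF sepF) => //.
  exact: depth_two_regular.
have ex := points_resolution_exact avc ave depthX res.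
have idJ : is_ideal (gen_ideal c e) := adjoin_ideal _ _.
have [t /adjoinP-/(_ idX) [s /(res_augmentation res) [w wE]]] :=
  (adjoinP _ _ (adjoin_ideal _ _)).1 FJ.
have Jw : mx_in (gen_ideal c e) (F%:M - w *m delta 0%N).
  rewrite wE -raddfB /= => i j; rewrite !ord1 mxE mulr1n.
  apply/adjoinP; first exact: adjoin_ideal.
  exists t; apply/adjoinP; first exact: zero_ideal_ideal.
  by exists s; rewrite /zero_ideal; ring.
have inj (v : 'rV_(size F2)) : mx_in (gen_ideal c e) (v *m delta 1%N) ->
    mx_in (gen_ideal c e) v.
  move=> /(ex 1%N) [z]; rewrite (_ : z *m _ = 0) ?subr0 //.
  by apply/matrixP => i j; rewrite !mxE big_ord0.
have [u1 [u2 Ju]] := cone_map_mod idJ Jw w1E w2E uE (ex 0%N) inj.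
apply: (mx_in_congr irr (N := point_form true P *: u1 - point_form false P *: u2)).
  by move=> i j; apply/gen_ideal_sub_irrelevant/Ju.
have irrP b := linear_irrelevant (@point_form_bihomogeneous k b P).
by apply: mx_inB => // i j; rewrite mxE; apply: (is_idealMr _ irr).
Qed.

Local Close Scope ring_scope.
Local Open Scope fset_scope.

Theorem theorem4p9 (k : closedFieldType) (char0 : [pchar k]%R =i pred0)
    (X : {fset P1xP1 k}) (X_ACM : ACM X)
    (F1 F2 : free_module)
    (resX : has_minimal_resolution (ideal_of_points X) [:: F1; F2])
    (P : P1xP1 k) (PX : P \in X) (a1 a2 : nat)
    (degP : forall d, point_degree X P d <-> d = (a1, a2)) :
  ~ ACM (X `\ P) <->
  has_minimal_resolution (ideal_of_points (X `\ P))
    [:: F1 ++ [:: (a1, a2)];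
        F2 ++ [:: (a1.+1, a2); (a1, a2.+1)];
        [:: (a1.+1, a2.+1)]].
Proof.
split=> [nACM|resY [Y0|depthY]]; last 2 first.
- apply: (resolution_proper resY); rewrite Y0 -mpolyC1.
  by apply: (ideal_of_points_form (@bihomogeneousC k 1%R)) => Q; rewrite inE.
- exact: depth_two_resolution_length depthY resY.
have [[F [hF sepF]] _] := (degP _).2 erefl.
have IY f := ideal_delete_point f PX degP hF sepF.
have [Q QY] : exists Q, Q \in X `\ P.
  by apply/fset0Pn/eqP => Y0; apply: nACM; left.
have depthX : depth_quotient (ideal_of_points X) 2.
  by case: X_ACM PX => // ->; rewrite inE.
have [delta res] := resX.
apply: (cone_resolution res PX hF sepF IY QY).
apply: (cone_last_map_irrelevant res depthX PX hF sepF IY QY).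
by move=> depthY; apply: nACM; right.
Qed.
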